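(* Assume Hypothesis (H) (see context). Then there exist constants $C_1,C_2>0$, depending only on $\mathfrak e$ and $\gamma$, such that for every $\mu>0$ $$ \mathcal N^+(\hat{\bf h}_\mu,\mathfrak e_{\max})\le 1+C_1\,\mu\sum_{x\in\mathbb Z^d}|x|^{2-d+\gamma}|\hat v(x)|, \qquad \mathcal N^-(\hat{\bf h}_\mu,\mathfrak e_{\min})\le 1+C_2\,\mu\sum_{x\in\mathbb Z^d}|x|^{2-d+\gamma}|\hat v(x)|. $$ In particular, for every $\mu>0$ the number of eigenvalues of $\hat{\bf h}_\mu$ outside $[\mathfrak e_{\min},\mathfrak e_{\max}]$ is finite.
   Context: Let $d\in\{1,2\}$ and $\mathbb T^d=(-\pi,\pi]^d$ with normalized Haar measure $dp$ ($\int_{\mathbb T^d}dp=1$). Let $\hat{\mathfrak e}\in\ell^1(\mathbb Z^d)$ with $\overline{\hat{\mathfrak e}(-x)}=\hat{\mathfrak e}(x)$, and $\hat v:\mathbb Z^d\to\mathbb R$. On $\ell^2(\mathbb Z^d)$ define $(\hat{\bf h}_0\hat f)(x)=\sum_{y\in\mathbb Z^d}\hat{\mathfrak e}(y)\hat f(x+y)$, $(\hat{\bf v}\hat f)(x)=\hat v(x)\hat f(x)$, and $\hat{\bf h}_\mu=\hat{\bf h}_0+\mu\hat{\bf v}$, $\mu\ge0$. Let $\mathcal F:\ell^2(\mathbb Z^d)\to L^2(\mathbb T^d)$, $(\mathcal F\hat f)(p)=\sum_x\hat f(x)e^{ix\cdot p}$, with inverse $(\mathcal F^*f)(x)=\int_{\mathbb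 T^d}f(p)e^{-ix\cdot p}dp$. Set $\mathfrak e:=\mathcal F\hat{\mathfrak e}$ (a continuous real function on $\mathbb T^d$), $\mathfrak e_{\min}=\min\mathfrak e$, $\mathfrak e_{\max}=\max\mathfrak e$. Hypothesis (H): (a) $\mathfrak e$ has a unique minimum point $p_0$ and a unique maximum point $p^0$, $\mathfrak e$ is $C^2$ in a neighbourhood of $p_0$ and of $p^0$, and both critical points are non-degenerate (invertible Hessian); (b) there exists $\gamma\in(0,1)$ with $0<\sum_{x\in\mathbb Z^d}|x|^{2-d+\gamma}|\hat v(x)|<\infty$. Under (H), $\hat v\in\ell^1$ and $\sigma_{ess}(\hat{\bf h}_\mu)=[\mathfrak e_{\min},\mathfrak e_{\max}]$. For a self-adjoint operator $A$ and $\lambda\in\mathbb R$, $\mathcal N^+(A,\lambda)$ (resp. $\mathcal N^-(A,\lambda)$) denotes the number of eigenvalues of $A$ in $(\lambda,\infty)$ (resp. $(-\infty,\lambda)$), counted with multiplicity. *)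

(* Defs.v *)
From HB Require Import structures.
From mathcomp Require Import all_boot all_order all_algebra.
From mathcomp Require Import all_classical all_reals all_analysis.
From mathcomp Require Import complex.
Set Implicit Arguments. Unset Strict Implicit. Unset Printing Implicit Defensive.
Import Order.TTheory GRing.Theory Num.Theory.
Import numFieldNormedType.Exports.
Local Open Scope classical_set_scope.
Local Open Scope ring_scope.

Section Defs.
Variable R : realType.

Definition Zd (d : nat) := {ffun 'I_d -> int}.

Definition znorm d (x : Zd d) : R := Num.sqrt (\sum_(i < d) ((x i)%:~R : R) ^+ 2).

Definition cmod (z : R[i]) : R := Num.sqrt (complex.Re z ^+ 2 + complex.Im z ^+ 2).

Definition cconj (z : R[i]) : R[i] := Complex (complex.Re z) (- complex.Im z).

Definition expi (t : R) : R[i] := Complex (cos t) (sin t).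

Definition abs_summable (T : choiceType) (g : T -> R[i]) : Prop :=
  (\esum_(x in [set: T]) (cmod (g x))%:E < +oo)%E.
Definition ell2 (T : choiceType) (f : T -> R[i]) : Prop :=
  (\esum_(x in [set: T]) ((cmod (f x)) ^+ 2)%:E < +oo)%E.

Definition rsum (T : choiceType) (g : T -> R) : R :=
  fine (\esum_(x in [set: T]) (Num.max (g x) 0)%:E) -
  fine (\esum_(x in [set: T]) (Num.max (- g x) 0)%:E).

Definition csum (T : choiceType) (g : T -> R[i]) : R[i] :=
  Complex (rsum (fun x => complex.Re (g x))) (rsum (fun x => complex.Im (g x))).

Definition h0 d (eh : Zd d -> R[i]) (f : Zd d -> R[i]) (x : Zd d) : R[i] :=
  csum (fun y : Zd d => eh y * f (x + y)).
Definition hmu d (eh : Zd d -> R[i]) (v : Zd d -> R) (mu : R)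
  (f : Zd d -> R[i]) (x : Zd d) : R[i] :=
  h0 eh f x + ((mu * v x)%:C)%C * f x.

Definition is_eigvec d (A : (Zd d -> R[i]) -> (Zd d -> R[i])) (f : Zd d -> R[i]) (E : R) :=
  ell2 f /\ (exists x, f x != 0) /\ (forall x, A f x = (E%:C)%C * f x).

Definition lin_indep d n (fs : 'I_n -> Zd d -> R[i]) :=
  forall c : 'I_n -> R[i], (forall x, \sum_(k < n) c k * fs k x = 0) -> forall k, c k = 0.

Definition dotp d (x : Zd d) (p : 'rV[R]_d) : R := \sum_(i < d) (x i)%:~R * p ord0 i.
Definition torus d : set 'rV[R]_d := [set p | forall i, - pi < p ord0 i <= pi].

(* The symbol e = F ehat, e(p) = sum_x ehat(x) e^{i x.p} (real, we take the real part) *)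
Definition efun d (eh : Zd d -> R[i]) (p : 'rV[R]_d) : R :=
  complex.Re (csum (fun x => eh x * expi (dotp x p))).
Definition emin d (eh : Zd d -> R[i]) : R := inf [set efun eh p | p in @torus d].
Definition emax d (eh : Zd d -> R[i]) : R := sup [set efun eh p | p in @torus d].

Definition unitv d (i : 'I_d) : 'rV[R]_d := delta_mx ord0 i.
Definition partial d (i : 'I_d) (g : 'rV[R]_d -> R) (p : 'rV[R]_d) : R :=
  derive g p (unitv i).

Definition C2_on d (U : set 'rV[R]_d) (g : 'rV[R]_d -> R) : Prop :=
  {in U, continuous g} /\
  (forall i, (forall p, U p -> derivable g p (unitv i)) /\ {in U, continuous (partial i g)}) /\
  (forall i j, (forall p, U p -> derivable (partial i g) p (unitv j)) /\
               {in U, continuous (partial j (partial i g))}).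

Definition hessian d (g : 'rV[R]_d -> R) (p : 'rV[R]_d) : 'M[R]_d :=
  \matrix_(i, j) partial j (partial i g) p.

Definition nondeg_C2_at d (g : 'rV[R]_d -> R) (p0 : 'rV[R]_d) : Prop :=
  (exists U, open U /\ U p0 /\ C2_on U g) /\ hessian g p0 \in unitmx.

Definition hyp_a d (eh : Zd d -> R[i]) : Prop :=
  (exists p0, @torus d p0 /\ (forall p, @torus d p -> efun eh p0 <= efun eh p) /\
     (forall p, @torus d p -> efun eh p = efun eh p0 -> p = p0) /\
     nondeg_C2_at (efun eh) p0) /\
  (exists p1, @torus d p1 /\ (forall p, @torus d p -> efun eh p <= efun eh p1) /\
     (forall p, @torus d p -> efun eh p = efun eh p1 -> p = p1) /\
     nondeg_C2_at (efun eh) p1).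

Definition wsum d (gamma : R) (v : Zd d -> R) : \bar R :=
  \esum_(x in [set: Zd d]) (powR (znorm x) (2 - d%:R + gamma) * `|v x|)%:E.

End Defs.
Arguments torus {R} d.

(* Main.v *)
Require Import Defs.
From HB Require Import structures.
From mathcomp Require Import all_boot all_order all_algebra finmap.
From mathcomp Require Import all_classical all_reals all_analysis.
From mathcomp Require Import complex ring lra zify.
Set Implicit Arguments. Unset Strict Implicit. Unset Printing Implicit Defensive.
Import Order.TTheory GRing.Theory Num.Theory.
Import numFieldNormedType.Exports.
Local Open Scope classical_set_scope.
Local Open Scope ring_scope.

(** Write [E] for the maximum of the symbol [e] and [Q f = <f, (E - h_0) f>].
  On the span of eigenvectors with eigenvalues above [E] one has
  [Q f <= mu * sum |v x| |f x|^2].  If moreover [f 0 = 0], then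
  [f x = int F(p) (e^{ixp} - e^{ixp1}) dp], where [p1] is the maximum point of [e],
  and Cauchy-Schwarz with weight [E - e(p) >= c |p - p1|^2] gives
  [|f x|^2 <= C |x|^(2-d+gamma) Q f].  The condition [f 0 = 0] costs at most one
  dimension; summing both inequalities over a [Q]-orthonormal basis of what is left,
  on which [sum_i |g_i x|^2 <= C |x|^(2-d+gamma)], bounds its dimension by
  [C mu sum |x|^(2-d+gamma) |v x|].

  The Fourier integrals are replaced by finite sums: for finitely supported [f] one
  samples on a grid of [N^d] points placed symmetrically around [p1] ([N] even, so that
  [p1] itself is avoided), where Fourier inversion is exact once [N] exceeds the diameter
  of the support.  The bound for the minimum follows by changing the signs of [ehat] and
  [v]. *)

(** * Absolutely summable families *)

(** In dimensions one and two [1/|q|^2] is not integrable at the origin, so the weight alone does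
    not suffice for Cauchy-Schwarz; the subtracted phase supplies the missing decay. Since
    [|e^{ixq} - 1|^2 <= 4 |x|^a |q|^a] for [0 <= a <= 2], the choice [a = 2 - d + gamma] leaves
    [|q|^(gamma - d)], which is integrable because [gamma > 0]. This is the origin of the weight
    [|x|^(2-d+gamma)]. The symbol enters the constant only through the [c] of the quadratic lower
    bound. Eigenvectors need not have finite support, so the estimates are made on truncations to a
    finite set [A] and passed to the limit over finite sets. Truncation preserves [f 0 = 0], and the
    truncated forms are Hermitian; this is the only trace of self-adjointness, and orthogonality of
    eigenvectors follows from it. Truncation does not preserve the eigenvalue equation, but the
    defect tends to zero. *)

Section Modulus.
Variable R : realType.
Implicit Types z w : R[i].

Lemma cmodE z : (cmod z)%:C%C = `|z|.
Proof. by rewrite normc_def. Qed.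

Lemma cmod_ge0 z : 0 <= cmod z.
Proof. exact: sqrtr_ge0. Qed.

Lemma cmodM z w : cmod (z * w) = cmod z * cmod w.
Proof. by apply: complexI; rewrite rmorphM /= !cmodE normrM. Qed.

Lemma cmodD z w : cmod (z + w) <= cmod z + cmod w.
Proof. by rewrite -lecR rmorphD /= !cmodE ler_normD. Qed.

Lemma cmodN z : cmod (- z) = cmod z.
Proof. by apply: complexI; rewrite !cmodE normrN. Qed.

Lemma cmod0 : cmod (0 : R[i]) = 0.
Proof. by apply: complexI; rewrite cmodE normr0. Qed.

Lemma cmod_eq0 z : (cmod z == 0) = (z == 0).
Proof. by rewrite -(inj_eq (@complexI _)) cmodE normr_eq0. Qed.

Lemma cmodJ z : cmod z^*%C = cmod z.
Proof. by apply: complexI; rewrite !cmodE normcJ. Qed.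

Lemma cmodR (a : R) : cmod a%:C%C = `|a|.
Proof. by rewrite /cmod /= expr0n /= addr0 sqrtr_sqr. Qed.

Lemma cmodB z w : cmod (z - w) = cmod (w - z).
Proof. by rewrite -cmodN opprB. Qed.

Lemma sqr_cmod z : cmod z ^+ 2 = complex.Re z ^+ 2 + complex.Im z ^+ 2.
Proof. by rewrite sqr_sqrtr // addr_ge0 ?sqr_ge0. Qed.

Lemma mulJc z : z^*%C * z = (cmod z ^+ 2)%:C%C.
Proof. by rewrite mulrC -sqr_normc -cmodE rmorphXn. Qed.

Lemma cconjE z : cconj z = z^*%C.
Proof. by case: z. Qed.

Lemma cmod_Re z : `|complex.Re z| <= cmod z.
Proof. by rewrite -lecR cmodE normc_ge_Re. Qed.

Lemma cmod_Im z : `|complex.Im z| <= cmod z.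
Proof.
rewrite -(ler_pXn2r (n := 2)) ?nnegrE ?cmod_ge0 //.
by rewrite sqr_cmod real_normK ?num_real // lerDr sqr_ge0.
Qed.

Lemma cmod_le_ReIm z : cmod z <= `|complex.Re z| + `|complex.Im z|.
Proof.
rewrite -(ler_pXn2r (n := 2)) ?nnegrE ?cmod_ge0 ?addr_ge0 //.
rewrite sqr_cmod sqrrD !real_normK ?num_real //.
by rewrite lerD2r lerDl mulrn_wge0 // mulr_ge0.
Qed.

Lemma cmod_sum (I : Type) (r : seq I) (P : pred I) (F : I -> R[i]) :
  cmod (\sum_(i <- r | P i) F i) <= \sum_(i <- r | P i) cmod (F i).
Proof.
elim/big_ind2 : _ => [|x a y b xa yb|//]; first by rewrite cmod0.
exact: le_trans (cmodD _ _) (lerD xa yb).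
Qed.

Lemma ReD z w : complex.Re (z + w) = complex.Re z + complex.Re w.
Proof. by case: z; case: w. Qed.

Lemma ReN z : complex.Re (- z) = - complex.Re z.
Proof. by case: z. Qed.

Lemma ImD z w : complex.Im (z + w) = complex.Im z + complex.Im w.
Proof. by case: z; case: w. Qed.

Lemma ImN z : complex.Im (- z) = - complex.Im z.
Proof. by case: z. Qed.

Lemma Re_sum (I : Type) (r : seq I) (P : pred I) (F : I -> R[i]) :
  complex.Re (\sum_(i <- r | P i) F i) = \sum_(i <- r | P i) complex.Re (F i).
Proof. by elim/big_rec2 : _ => // i x y _ <-; rewrite ReD. Qed.

Lemma Im_sum (I : Type) (r : seq I) (P : pred I) (F : I -> R[i]) :
  complex.Im (\sum_(i <- r | P i) F i) = \sum_(i <- r | P i) complex.Im (F i).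
Proof. by elim/big_rec2 : _ => // i x y _ <-; rewrite ImD. Qed.

Lemma conjc_sum (I : Type) (r : seq I) (P : pred I) (F : I -> R[i]) :
  (\sum_(i <- r | P i) F i)^*%C = \sum_(i <- r | P i) (F i)^*%C.
Proof. exact: rmorph_sum. Qed.

Lemma conjcD z w : (z + w)^*%C = z^*%C + w^*%C.
Proof. exact: rmorphD. Qed.

Lemma conjcB z w : (z - w)^*%C = z^*%C - w^*%C.
Proof. exact: rmorphB. Qed.

Lemma conjcM z w : (z * w)^*%C = z^*%C * w^*%C.
Proof. exact: rmorphM. Qed.

Lemma ReZ (a : R) z : complex.Re (a%:C%C * z) = a * complex.Re z.
Proof. by case: z => x y /=; rewrite mul0r subr0. Qed.

End Modulus.

Section Summation.
Variables (R : realType) (T : choiceType).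
Implicit Types (g : T -> R) (A B : {fset T}).

Lemma sum_fsetU_disj (V : nmodType) (F : T -> V) A B : (A `<=` B)%fset ->
  \sum_(x <- B) F x = \sum_(x <- A) F x + \sum_(x <- (B `\` A)%fset) F x.
Proof.
move=> AB; rewrite (big_fsetID _ (mem A)) /=; congr (_ + _).
  by apply: eq_fbigl => x; rewrite !inE; case: (boolP (x \in A)) => xA;
     rewrite ?andbT ?andbF //; exact: (fsubsetP AB).
by apply: eq_fbigl => x; rewrite !inE andbC.
Qed.

Lemma ler_sum_fsubset g A B : (forall x, 0 <= g x) -> (A `<=` B)%fset ->
  \sum_(x <- A) g x <= \sum_(x <- B) g x.
Proof.
by move=> g0 /(sum_fsetU_disj g) ->; rewrite lerDl sumr_ge0.
Qed.

(** [fine] sends an infinite sum to [0], so the estimates below carry a summability hypothesis. *)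
Definition esumr g : R := fine (\esum_(x in [set: T]) (g x)%:E).

Lemma fsum_le_esum g A : (forall x, 0 <= g x) ->
  ((\sum_(x <- A) g x)%:E <= \esum_(x in [set: T]) (g x)%:E)%E.
Proof.
move=> g0; apply: esum_ge; exists [set` A].
  by split => //; exact: finite_fset.
by rewrite -sumEFin fsbig_seq //= fset_uniq.
Qed.

Lemma esum_lty_fin g : (forall x, 0 <= g x) ->
  (\esum_(x in [set: T]) (g x)%:E < +oo)%E ->
  (\esum_(x in [set: T]) (g x)%:E)%E = (esumr g)%:E.
Proof.
move=> g0 gf; rewrite /esumr fineK // ge0_fin_numE //.
by apply: esum_ge0 => x _; rewrite lee_fin.
Qed.

Lemma fsum_le_esumr g A : (forall x, 0 <= g x) ->
  (\esum_(x in [set: T]) (g x)%:E < +oo)%E ->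
  \sum_(x <- A) g x <= esumr g.
Proof.
by move=> g0 gf; rewrite -lee_fin -esum_lty_fin //; exact: fsum_le_esum.
Qed.

Lemma esum_lty_bound g (M : R) : (forall A, \sum_(x <- A) g x <= M) ->
  (\esum_(x in [set: T]) (g x)%:E < +oo)%E.
Proof.
move=> gM; apply: (@le_lt_trans _ _ M%:E); last exact: ltry.
apply: ge_ereal_sup => _ [X [finX _] <-].
by rewrite fsbig_finite //= sumEFin lee_fin.
Qed.

Lemma esumr_approx g (e : R) : (forall x, 0 <= g x) ->
  (\esum_(x in [set: T]) (g x)%:E < +oo)%E -> 0 < e ->
  exists A0 : {fset T}, forall A, (A0 `<=` A)%fset ->
    esumr g - e <= \sum_(x <- A) g x.
Proof.
move=> g0 gf e0.
have : (\esum_(x in [set: T]) (g x)%:E)%E \is a fin_num.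
  by rewrite esum_lty_fin.
move=> /(ub_ereal_sup_adherent e0)[_ [X [finX _] <-]] /ltW.
rewrite -/(esum _ _) esum_lty_fin // fsbig_finite //= sumEFin -EFinB lee_fin.
move=> h; exists (fset_set X) => A XA.
exact: le_trans h (ler_sum_fsubset g0 XA).
Qed.

(** Cauchy criterion: once the sum over [A0] is within [e] of the total, a block disjoint from [A0]
    can add at most [e]. *)
Lemma esum_tail g (e : R) : (forall x, 0 <= g x) ->
  (\esum_(x in [set: T]) (g x)%:E < +oo)%E -> 0 < e ->
  exists A0 : {fset T}, forall B, [disjoint A0 & B]%fset ->
    \sum_(x <- B) g x <= e.
Proof.
move=> g0 gf e0; have [A0 hA0] := esumr_approx g0 gf e0.
exists A0 => B dAB.
have := fsum_le_esumr (A0 `|` B)%fset g0 gf.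
rewrite (@sum_fsetU_disj _ _ A0) ?fsubsetUl //.
have -> : ((A0 `|` B) `\` A0)%fset = B.
  apply/fsetP => x; rewrite !inE.
  case: (boolP (x \in A0)) => //= xA; apply/esym/negbTE.
  by move/fdisjointP : dAB; apply.
have := hA0 A0 (fsubset_refl _); lra.
Qed.

(** The partial sums of the positive and of the negative part both err from below, by at most [e].
    In the difference these errors have opposite signs, so the bound is [e] and not [2 e]. *)
Lemma rsum_approx g (e : R) :
  (\esum_(x in [set: T]) `|g x|%:E < +oo)%E -> 0 < e ->
  exists A0 : {fset T}, forall A, (A0 `<=` A)%fset ->
    `|rsum g - \sum_(x <- A) g x| <= e.
Proof.
move=> gf e0.
pose p x := Num.max (g x) 0; pose q x := Num.max (- g x) 0.
have p0 x : 0 <= p x by rewrite le_max lexx orbT.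
have q0 x : 0 <= q x by rewrite le_max lexx orbT.
have pf : (\esum_(x in [set: T]) (p x)%:E < +oo)%E.
  apply: le_lt_trans gf; apply: le_esum => x _; rewrite lee_fin /p.
  by rewrite ge_max ler_norm normr_ge0.
have qf : (\esum_(x in [set: T]) (q x)%:E < +oo)%E.
  apply: le_lt_trans gf; apply: le_esum => x _; rewrite lee_fin /q.
  by rewrite ge_max -normrN ler_norm normr_ge0.
have [A1 hA1] := esumr_approx p0 pf e0.
have [A2 hA2] := esumr_approx q0 qf e0.
exists (A1 `|` A2)%fset => A; rewrite fsubUset => /andP[/hA1 h1 /hA2 h2].
have k1 := fsum_le_esumr A p0 pf; have k2 := fsum_le_esumr A q0 qf.
have -> : \sum_(x <- A) g x = \sum_(x <- A) p x - \sum_(x <- A) q x.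
  rewrite -sumrB; apply: eq_bigr => x _; rewrite /p /q.
  have [gx|/ltW gx] := leP (g x) 0.
    by rewrite max_l ?sub0r ?opprK ?oppr_ge0.
  by rewrite max_r ?subr0 ?oppr_le0.
by rewrite /rsum -/(esumr p) -/(esumr q) ler_norml; apply/andP; split; lra.
Qed.


Lemma abs_summable_bound (h : T -> R[i]) A : abs_summable h ->
  \sum_(x <- A) cmod (h x) <= esumr (fun x => cmod (h x)).
Proof. by move=> hs; apply: fsum_le_esumr => // x; exact: cmod_ge0. Qed.

(** Convergence along finite sets directed by inclusion. It is stated for arbitrary functions of [A]
    because the forms below, such as double sums over pairs from [A], are not partial sums of a
    family indexed by [T]. *)
Definition netlim (u : {fset T} -> R[i]) (l : R[i]) :=
  forall e : R, 0 < e -> exists A0 : {fset T}, forall A, (A0 `<=` A)%fset ->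
    cmod (u A - l) <= e.

Lemma csum_netlim (h : T -> R[i]) : abs_summable h ->
  netlim (fun A => \sum_(x <- A) h x) (csum h).
Proof.
move=> hs e e0; have e20 : 0 < e / 2 by rewrite divr_gt0.
have Res : (\esum_(x in [set: T]) `|complex.Re (h x)|%:E < +oo)%E.
  by apply: le_lt_trans hs; apply: le_esum => x _; rewrite lee_fin cmod_Re.
have Ims : (\esum_(x in [set: T]) `|complex.Im (h x)|%:E < +oo)%E.
  by apply: le_lt_trans hs; apply: le_esum => x _; rewrite lee_fin cmod_Im.
have [A1 h1] := rsum_approx Res e20; have [A2 h2] := rsum_approx Ims e20.
exists (A1 `|` A2)%fset => A; rewrite fsubUset => /andP[/h1 k1 /h2 k2].
apply: le_trans (cmod_le_ReIm _) _; rewrite ReD ReN ImD ImN Re_sum Im_sum /=.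
rewrite distrC (distrC _ (rsum (fun x => complex.Im (h x)))).
by rewrite (splitr e) lerD.
Qed.

Lemma eq_netlim u v l : u =1 v -> netlim u l -> netlim v l.
Proof. by move=> /funext ->. Qed.

Lemma netlimD u v l m : netlim u l -> netlim v m ->
  netlim (fun A => u A + v A) (l + m).
Proof.
move=> ul vm e e0; have e20 : 0 < e / 2 by rewrite divr_gt0.
have [A1 h1] := ul _ e20; have [A2 h2] := vm _ e20.
exists (A1 `|` A2)%fset => A; rewrite fsubUset => /andP[/h1 k1 /h2 k2].
by rewrite opprD addrACA (le_trans (cmodD _ _)) // (splitr e) lerD.
Qed.

Lemma netlimZ (c : R[i]) u l : netlim u l -> netlim (fun A => c * u A) (c * l).
Proof.
move=> ul e e0; have c0 : 0 < cmod c + 1 by rewrite ltr_wpDl ?cmod_ge0.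
have [A1 h1] := ul _ (divr_gt0 e0 c0).
exists A1 => A /h1 k; rewrite -mulrBr cmodM.
apply: le_trans (_ : (cmod c + 1) * (e / (cmod c + 1)) <= _).
  by apply: ler_pM; rewrite ?cmod_ge0 // lerDl.
by rewrite mulrC divfK // gt_eqF.
Qed.

Lemma netlimB u v l m : netlim u l -> netlim v m ->
  netlim (fun A => u A - v A) (l - m).
Proof.
move=> ul vm; rewrite -(mulN1r m).
under [X in netlim X _]eq_fun do rewrite -mulN1r.
exact: netlimD ul (netlimZ (-1) vm).
Qed.

Lemma netlimJ u l : netlim u l -> netlim (fun A => (u A)^*%C) (l^*%C).
Proof.
move=> ul e /ul[A1 h1]; exists A1 => A /h1.
by rewrite -rmorphB /= cmodJ.
Qed.

Lemma netlim_cst c : netlim (fun=> c) c.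
Proof. by move=> e e0; exists fset0 => A _; rewrite subrr cmod0 ltW. Qed.

Lemma netlim_sum (I : Type) (r : seq I) (u : I -> {fset T} -> R[i]) l :
  (forall i, netlim (u i) (l i)) ->
  netlim (fun A => \sum_(i <- r) u i A) (\sum_(i <- r) l i).
Proof.
move=> ul; elim: r => [|i r IH].
  rewrite big_nil; under [X in netlim X _]eq_fun do rewrite big_nil.
  exact: netlim_cst.
rewrite big_cons; under [X in netlim X _]eq_fun do rewrite big_cons.
exact: netlimD.
Qed.

Lemma netlim_sum0 (I : Type) (r : seq I) (u : I -> {fset T} -> R[i]) :
  (forall i, netlim (u i) 0) -> netlim (fun A => \sum_(i <- r) u i A) 0.
Proof. by move=> /(netlim_sum r); rewrite big1. Qed.

Lemma netlim_uniq u l m : netlim u l -> netlim u m -> l = m.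
Proof.
move=> ul um; apply/eqP; rewrite -subr_eq0 -cmod_eq0 eq_le cmod_ge0 andbT.
apply/ler_addgt0Pr => e e0; rewrite add0r.
have e20 : 0 < e / 2 by rewrite divr_gt0.
have [A1 h1] := ul _ e20; have [A2 h2] := um _ e20.
have k1 := h1 _ (fsubsetUl A1 A2); have k2 := h2 _ (fsubsetUr A1 A2).
rewrite -(subrKA (u (A1 `|` A2)%fset)) (le_trans (cmodD _ _)) //.
by rewrite (splitr e) lerD // cmodB.
Qed.

Lemma netlim_squeeze u v l : netlim u l -> netlim (fun A => u A - v A) 0 ->
  netlim v l.
Proof.
move=> ul uv; have := netlimB ul uv; rewrite subr0.
by under [X in netlim X _]eq_fun do rewrite opprB addrC subrK.
Qed.

End Summation.

(** * Quadratic forms of the hopping operator and their truncations *)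

Section DoubleSums.
Variables (R : realType).

Lemma sum_fsetM (T U : choiceType) (V : nmodType) (F : T * U -> V)
    (A : {fset T}) (B : {fset U}) :
  \sum_(p <- (A `*` B)%fset) F p = \sum_(x <- A) \sum_(y <- B) F (x, y).
Proof.
rewrite (perm_big [seq (x, y) | x <- A, y <- B]) ?big_allpairs //.
apply: uniq_perm; rewrite ?fset_uniq //.
  by apply: allpairs_uniq; rewrite ?fset_uniq // => -[a b] [c e] _ _ [-> ->].
move=> [x y]; rewrite in_fsetM /=; apply/andP/allpairsP.
  by move=> [xA yB]; exists (x, y).
by move=> [[a b] /= [aA bB [-> ->]]].
Qed.

Lemma sum_fset_shift (T : zmodType) (V : nmodType) (F : T -> V)
    (A : {fset T}) (z : T) :
  \sum_(x <- A) F (x + z) = \sum_(y <- [fset (x + z)%R | x in A]%fset) F y.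
Proof. by rewrite big_imfset //= => x y _ _ /addIr. Qed.

Variables (d : nat) (eh : Zd d -> R[i]).
Hypothesis eh1 : abs_summable eh.
Implicit Types (f g : Zd d -> R[i]) (A B : {fset Zd d}).

Let w z := cmod (eh z).
Let N1 := esumr w.
Let N2 f := esumr (fun x => cmod (f x) ^+ 2).

Lemma fsum_le_ell2 f A : ell2 f -> \sum_(x <- A) cmod (f x) ^+ 2 <= N2 f.
Proof. by move=> hf; apply: fsum_le_esumr => // x; exact: sqr_ge0. Qed.

Lemma ell2_abs_summable f g : ell2 f -> ell2 g ->
  abs_summable (fun x => (f x)^*%C * g x).
Proof.
move=> hf hg; apply: (@esum_lty_bound _ _ _ (N2 f + N2 g)) => A.
apply: le_trans (lerD (fsum_le_ell2 A hf) (fsum_le_ell2 A hg)).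
rewrite -big_split; apply: ler_sum => x _ /=; rewrite cmodM cmodJ.
have := sqr_ge0 (cmod (f x) - cmod (g x)).
have := cmod_ge0 (f x); have := cmod_ge0 (g x); nra.
Qed.

(** Summand of [<f, h_0 g>] at the pair of sites [(x, x + y)] instead of [(x, y)]; the symmetry of
    [eh] then exchanges the two coordinates. *)
Definition hkernel f g (p : Zd d * Zd d) : R[i] :=
  (f p.1)^*%C * eh (p.2 - p.1) * g p.2.

Lemma hkernel_le f g p : cmod (hkernel f g p) <=
  w (p.2 - p.1) * cmod (f p.1) ^+ 2 + w (p.2 - p.1) * cmod (g p.2) ^+ 2.
Proof.
rewrite /hkernel !cmodM cmodJ -mulrDr -/(w _) [_ * w _]mulrC -mulrA.
apply: ler_wpM2l; first exact: cmod_ge0.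
have := sqr_ge0 (cmod (f p.1) - cmod (g p.2)).
have := cmod_ge0 (f p.1); have := cmod_ge0 (g p.2); nra.
Qed.

(** Schur test: in each of the two terms of [hkernel_le] the variable that occurs only in [eh] is
    summed before the other, which gives the factor [N1]. *)
Lemma hkernel_summable f g : ell2 f -> ell2 g -> abs_summable (hkernel f g).
Proof.
move=> hf hg; apply: (@esum_lty_bound _ _ _ (N1 * N2 f + N1 * N2 g)) => S.
pose A := [fset p.1 | p in S]%fset; pose B := [fset p.2 | p in S]%fset.
have SAB : (S `<=` A `*` B)%fset.
  apply/fsubsetP => p pS; rewrite in_fsetM.
  by apply/andP; split; apply/imfsetP; exists p.
apply: le_trans (ler_sum_fsubset (fun=> cmod_ge0 _) SAB) _.
apply: le_trans (ler_sum _ (fun p _ => hkernel_le f g p)) _.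
have w1 (C : {fset Zd d}) : \sum_(z <- C) w z <= N1 by exact: abs_summable_bound.
rewrite big_split lerD // sum_fsetM /=.
  apply: le_trans (_ : \sum_(x <- A) N1 * cmod (f x) ^+ 2 <= _).
    apply: ler_sum => x _; rewrite -mulr_suml ler_wpM2r ?sqr_ge0 //.
    by rewrite (sum_fset_shift w B (- x)).
  rewrite -mulr_sumr ler_wpM2l ?fsum_le_ell2 //.
  by apply: le_trans (w1 fset0); rewrite big_nil.
rewrite exchange_big /=.
apply: le_trans (_ : \sum_(y <- B) N1 * cmod (g y) ^+ 2 <= _).
  apply: ler_sum => y _; rewrite -mulr_suml ler_wpM2r ?sqr_ge0 //.
  have -> : \sum_(x <- A) w (y - x) =
      \sum_(z <- [fset (y - x)%R | x in A]%fset) w z; last exact: w1.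
  by rewrite [RHS]big_imfset //= => a b _ _ /addrI/oppr_inj.
rewrite -mulr_sumr ler_wpM2l ?fsum_le_ell2 //.
by apply: le_trans (w1 fset0); rewrite big_nil.
Qed.

(** Both variables range over [A]: this is [<f_A, h_0 g_A>] for the truncations to [A], the quantity
    that the finite Fourier transform computes. *)
Definition hform f g A : R[i] := \sum_(x <- A) \sum_(y <- A) hkernel f g (x, y).
Definition gform f g A : R[i] := \sum_(x <- A) (f x)^*%C * g x.

Lemma gform_netlim f g : ell2 f -> ell2 g ->
  netlim (gform f g) (csum (fun x => (f x)^*%C * g x)).
Proof. by move=> hf hg; apply: csum_netlim; exact: ell2_abs_summable. Qed.

Lemma hform_netlim f g : ell2 f -> ell2 g ->
  netlim (hform f g) (csum (hkernel f g)).
Proof.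
move=> hf hg e /(csum_netlim (hkernel_summable hf hg))[S hS].
exists ([fset p.1 | p in S] `|` [fset p.2 | p in S])%fset => A.
rewrite fsubUset => /andP[/fsubsetP A1 /fsubsetP A2].
rewrite /hform -sum_fsetM; apply: hS; apply/fsubsetP => p pS.
rewrite in_fsetM; apply/andP.
by split; [apply: A1|apply: A2]; apply/imfsetP; exists p.
Qed.

Lemma h0_summable g x : ell2 g -> abs_summable (fun y => eh y * g (x + y)).
Proof.
move=> hg.
apply: (@esum_lty_bound _ _ _ (N1 * (1 + N2 g))) => A.
apply: le_trans (_ : \sum_(y <- A) w y * (1 + N2 g) <= _); last first.
  rewrite -mulr_suml ler_wpM2r ?abs_summable_bound //.
  by rewrite addr_ge0 //; apply: le_trans (fsum_le_ell2 fset0 hg); rewrite big_nil.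
apply: ler_sum => y _; rewrite cmodM ler_wpM2l ?cmod_ge0 //.
have := fsum_le_ell2 [fset (x + y)%R]%fset hg; rewrite big_seq_fset1.
have := sqr_ge0 (cmod (g (x + y)) - 1); have := cmod_ge0 (g (x + y)); nra.
Qed.

(** Allows the eigenvalue equation, which involves the full [h0], to be used in truncated forms. The
    difference consists of the error made in computing [h0 eh g x] over a finite set [Y], and of the
    kernel on [A] times the complement of [A] in [Y], which lies in the tail of a summable
    family. *)
Lemma hform_h0 f g : ell2 f -> ell2 g ->
  netlim (fun A => hform f g A - gform f (h0 eh g) A) 0.
Proof.
move=> hf hg e e0; have e20 : 0 < e / 2 by rewrite divr_gt0.
have [S hS] := esum_tail (fun=> cmod_ge0 _) (hkernel_summable hf hg) e20.
exists ([fset p.1 | p in S] `|` [fset p.2 | p in S])%fset => A.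
rewrite fsubUset => /andP[_ /fsubsetP A2].
pose F := \sum_(x <- A) cmod (f x).
have F0 : 0 < F + 1 by rewrite ltr_wpDl // sumr_ge0 // => x _; exact: cmod_ge0.
(* With this precision the errors at the points of [A], weighted by [|f x|], add up to at most
   [e / 2]. *)
have h x := csum_netlim (h0_summable x hg) (divr_gt0 e20 F0).
have {h}[Z hZ] := choice h.
(* [Y] contains the translate of [Z x] by [x] for every [x] in [A], so one set serves all these
   points. *)
pose Y := (A `|` \bigcup_(x <- A) [fset (y + x)%R | y in Z x])%fset.
have YA : (A `<=` Y)%fset by exact: fsubsetUl.
rewrite subr0.
have -> : hform f g A - gform f (h0 eh g) A =
   (\sum_(x <- A) (f x)^*%C * (\sum_(y <- Y) eh (y - x) * g y - h0 eh g x)) -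
   \sum_(p <- (A `*` (Y `\` A))%fset) hkernel f g p.
  rewrite sum_fsetM /hform /gform -!sumrB; apply: eq_bigr => x _.
  have -> : \sum_(y <- Y) eh (y - x) * g y =
    \sum_(y <- A) eh (y - x) * g y + \sum_(y <- (Y `\` A)%fset) eh (y - x) * g y.
    exact: sum_fsetU_disj.
  have K B : \sum_(y <- B) hkernel f g (x, y) =
      (f x)^*%C * \sum_(y <- B) eh (y - x) * g y.
    by rewrite mulr_sumr; apply: eq_bigr => y _; rewrite /hkernel mulrA.
  by rewrite !K; ring.
rewrite (le_trans (cmodD _ _)) // (splitr e) cmodN lerD //; last first.
  (* Second coordinates in this block avoid [A], which contains those of [S]. *)
  apply: le_trans (cmod_sum _ _ _) _; apply: hS.
  apply/fdisjointP => p pS; rewrite in_fsetM !inE !negb_and negbK.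
  by rewrite (A2 p.2) ?orbT //; apply/imfsetP; exists p.
apply: le_trans (cmod_sum _ _ _) _.
apply: le_trans (_ : \sum_(x <- A) cmod (f x) * (e / 2 / (F + 1)) <= _).
  rewrite !big_seq; apply: ler_sum => x xA; rewrite cmodM cmodJ.
  rewrite ler_wpM2l ?cmod_ge0 //.
  have -> : \sum_(y <- Y) eh (y - x) * g y =
      \sum_(y <- [fset (y - x)%R | y in Y]%fset) eh y * g (x + y).
    rewrite -(sum_fset_shift (fun y => eh y * g (x + y)) Y (- x)).
    by apply: eq_bigr => y _; rewrite [x + _]addrC subrK.
  apply: hZ; apply/fsubsetP => y yZ; apply/imfsetP; exists (y + x) => /=.
    rewrite inE; apply/orP; right; apply/bigfcupP; exists x; rewrite ?andbT //.
    by apply/imfsetP; exists y.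
  by rewrite addrK.
rewrite -mulr_suml -/F mulrCA ler_piMr ?(ltW e20) //.
by rewrite ler_pdivrMr // mul1r lerDl.
Qed.

End DoubleSums.

(** * The counting argument *)

Section CountingLemma.
Variables (R : realType) (T : choiceType) (n : nat).
Implicit Types (c e : 'I_n -> R[i]).
Variables (Q : 'I_n -> 'I_n -> R[i]) (f : 'I_n -> T -> R[i]).

Definition lcomb c (x : T) : R[i] := \sum_k c k * f k x.

(** Vectors of the span are represented by their coefficients, so only the matrix [Q] of the form is
    needed; it will be a limit of truncated forms. *)
Definition sesq c e : R[i] := \sum_j \sum_k (c j)^*%C * e k * Q j k.

Lemma exists_null_vector (F : fieldType) (k : nat) (M : 'M[F]_(n, k)) :
  (k < n)%N -> exists2 u : 'rV[F]_n, u != 0 & u *m M = 0.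
Proof.
move=> kn; have : kermx M != 0.
  by rewrite -mxrank_eq0 mxrank_ker -lt0n subn_gt0 (leq_ltn_trans _ kn) ?rank_leq_col.
move=> /rowV0Pn[u /sub_kermxP uM u0]; by exists u.
Qed.

Hypothesis Qherm : forall j k, Q k j = (Q j k)^*%C.

Lemma sesq_herm c e : sesq e c = (sesq c e)^*%C.
Proof.
rewrite /sesq exchange_big rmorph_sum; apply: eq_bigr => j _.
rewrite rmorph_sum; apply: eq_bigr => k _ /=.
by rewrite !rmorphM /= conjcK -Qherm; ring.
Qed.

Lemma sesq_real c : sesq c c = (complex.Re (sesq c c))%:C%C.
Proof.
have := sesq_herm c c; case: (sesq c c) => a b [] /= /eqP.
by rewrite -addr_eq0 -mulr2n mulrn_eq0 /= => /eqP ->.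
Qed.

Lemma sesqZl a c e : sesq (fun k => a * c k) e = a^*%C * sesq c e.
Proof.
rewrite /sesq mulr_sumr; apply: eq_bigr => j _; rewrite mulr_sumr.
by apply: eq_bigr => k _; rewrite rmorphM /= !mulrA.
Qed.

Lemma sesqZr a c e : sesq c (fun k => a * e k) = a * sesq c e.
Proof. by rewrite sesq_herm sesqZl rmorphM /= conjcK -sesq_herm. Qed.

Lemma sesq_sumr (m : nat) (a : 'I_m -> R[i]) (g : 'I_m -> 'I_n -> R[i]) c :
  sesq c (fun k => \sum_i a i * g i k) = \sum_i a i * sesq c (g i).
Proof.
rewrite /sesq; under [RHS]eq_bigr do rewrite mulr_sumr.
rewrite [RHS]exchange_big; apply: eq_bigr => j _ /=.
under [RHS]eq_bigr do rewrite mulr_sumr.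
rewrite [RHS]exchange_big; apply: eq_bigr => k _ /=.
rewrite mulr_sumr mulr_suml; apply: eq_bigr => i _; ring.
Qed.

Lemma sesq_suml (m : nat) (a : 'I_m -> R[i]) (g : 'I_m -> 'I_n -> R[i]) c :
  sesq (fun k => \sum_i a i * g i k) c = \sum_i (a i)^*%C * sesq (g i) c.
Proof.
rewrite sesq_herm sesq_sumr rmorph_sum; apply: eq_bigr => i _ /=.
by rewrite rmorphM /= -sesq_herm.
Qed.

Lemma lcombZ a c x : lcomb (fun k => a * c k) x = a * lcomb c x.
Proof. by rewrite /lcomb mulr_sumr; apply: eq_bigr => k _; rewrite mulrA. Qed.

Lemma lcomb_sum (m : nat) (a : 'I_m -> R[i]) (g : 'I_m -> 'I_n -> R[i]) x :
  lcomb (fun k => \sum_i a i * g i k) x = \sum_i a i * lcomb (g i) x.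
Proof.
rewrite /lcomb; under [RHS]eq_bigr do rewrite mulr_sumr.
rewrite [RHS]exchange_big; apply: eq_bigr => k _ /=.
by rewrite mulr_suml; apply: eq_bigr => i _; rewrite mulrA.
Qed.

Variables (x0 : T) (w : T -> R).
Hypothesis f_free : forall c, (forall x, lcomb c x = 0) -> forall k, c k = 0.
Hypothesis eval_bound : forall c, lcomb c x0 = 0 ->
  forall x, cmod (lcomb c x) ^+ 2 <= w x * complex.Re (sesq c c).
Hypothesis w_ge0 : forall x, 0 <= w x.

(** Definiteness comes from the evaluation bound: a nonpositive value of the form forces all values
    of the combination to vanish, against independence. *)
Lemma sesq_gt0 c k : lcomb c x0 = 0 -> c k != 0 -> 0 < complex.Re (sesq c c).
Proof.
move=> c0; apply: contra_neqT; rewrite -leNgt => q0; move: k; apply: f_free => x.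
apply/eqP; rewrite -cmod_eq0 -sqrf_eq0 eq_le sqr_ge0 andbT.
rewrite (le_trans (eval_bound c0 x)) //.
by rewrite mulr_ge0_le0.
Qed.

(** A null vector takes the place of the projection: orthogonality to [k] vectors together with
    vanishing at [x0] are [k + 1] linear equations in [n] unknowns. The additional equation is the
    reason for stopping at [n - 1] vectors, and [sesq_gt0] permits the normalisation. *)
Lemma gram_schmidt (k : nat) : (k < n)%N ->
  exists g : nat -> 'I_n -> R[i],
    (forall i, (i < k)%N -> lcomb (g i) x0 = 0) /\
    (forall i j, (i < k)%N -> (j < k)%N -> sesq (g i) (g j) = (i == j)%:R).
Proof.
elim: k => [|k IH] kn; first by exists (fun _ _ => 0).
have [g [g0 gq]] := IH (ltnW kn).
pose M : 'M[R[i]]_(n, k.+1) := \matrix_(j, s)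
  if (s < k)%N then \sum_l (g s l)^*%C * Q l j else f j x0.
have [u u0 uM] := exists_null_vector M kn.
pose c := u ord0.
have c_x0 : lcomb c x0 = 0.
  have := congr1 (fun A : 'rV_k.+1 => A ord0 ord_max) uM; rewrite !mxE => <-.
  by apply: eq_bigr => j _; rewrite !mxE ltnn.
have gc i : (i < k)%N -> sesq (g i) c = 0.
  move=> ik; have := congr1 (fun A : 'rV_k.+1 => A ord0 (inord i)) uM.
  rewrite !mxE => E; rewrite -[RHS]E /sesq exchange_big; apply: eq_bigr => j _ /=.
  rewrite !mxE inordK ?ltnS ?(ltnW ik) // ik mulr_sumr.
  by apply: eq_bigr => l _; rewrite /c; ring.
have [k0 ck0] : exists k0, c k0 != 0.
  have /rV0Pn[k0 hk0] := u0; by exists k0.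
pose r := complex.Re (sesq c c); have r0 : 0 < r by apply: (sesq_gt0 (k := k0)).
pose s : R[i] := (Num.sqrt r)^-1%:C%C.
have s0 : Num.sqrt r != 0 by rewrite gt_eqF // sqrtr_gt0.
exists (fun i => if i == k then (fun l => s * c l) else g i); split=> [i|i j].
  by rewrite ltnS; case: eqP => [_ _|/eqP ik ik']; rewrite ?lcombZ ?c_x0 ?mulr0 // g0 // ltn_neqAle ik.
rewrite !ltnS; case: (eqVneq i k) => [->|ik] ik'; case: (eqVneq j k) => [->|jk] jk'.
- rewrite ?eqxx sesqZl sesqZr conjc_real sesq_real -/r /s -!rmorphM /=.
  rewrite mulrA -expr2 exprVn sqr_sqrtr ?(ltW r0) //.
  by rewrite mulVf ?gt_eqF.
- by rewrite ?eqxx 1?eq_sym ?(negbTE jk) sesqZl sesq_herm gc ?conjc0 ?mulr0 // ltn_neqAle jk.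
- by rewrite ?(negbTE ik) ?eqxx sesqZr gc ?mulr0 // ltn_neqAle ik.
- by apply: gq; rewrite ltn_neqAle ?ik ?jk.
Qed.

(* The evaluation at [x] has the dual norm [S = sum_i |g_i x|^2], attained at
   [sum_i conj(g_i x) g_i], so that the pointwise bound reads [S^2 <= w x * S]. *)
Lemma orthonormal_eval_bound (m : nat) (g : 'I_m -> 'I_n -> R[i]) x :
  (forall i, lcomb (g i) x0 = 0) ->
  (forall i j, sesq (g i) (g j) = (i == j)%:R) ->
  \sum_i cmod (lcomb (g i) x) ^+ 2 <= w x.
Proof.
move=> g0 gq; pose a i := (lcomb (g i) x)^*%C.
pose S := \sum_i cmod (lcomb (g i) x) ^+ 2.
pose c := fun k => \sum_i a i * g i k.
have S0 : 0 <= S by apply: sumr_ge0 => i _; exact: sqr_ge0.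
have c0 : lcomb c x0 = 0.
  by rewrite lcomb_sum big1 // => i _; rewrite g0 mulr0.
have cx : lcomb c x = S%:C%C.
  by rewrite lcomb_sum rmorph_sum; apply: eq_bigr => i _; rewrite mulJc.
have cq : sesq c c = S%:C%C.
  rewrite sesq_suml rmorph_sum; apply: eq_bigr => i _ /=.
  rewrite sesq_sumr (bigD1 i) //= gq eqxx big1 ?addr0 => [|j ji].
    by rewrite mulr1 /a conjcK -mulJc mulrC.
  by rewrite gq eq_sym (negbTE ji) mulr0.
have := eval_bound c0 x; rewrite cx cq cmodR /= ger0_norm // -/S.
move: S0; rewrite le_eqVlt => /orP[/eqP <- _|S0]; first exact: w_ge0.
by rewrite expr2 ler_pM2r.
Qed.

Lemma dim_bound (V : T -> R) (B : R) : (forall x, 0 <= V x) ->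
  (forall A : {fset T}, \sum_(x <- A) V x * w x <= B) ->
  (forall c (e : R), 0 < e -> exists A0 : {fset T}, forall A, (A0 `<=` A)%fset ->
    complex.Re (sesq c c) <= \sum_(x <- A) V x * cmod (lcomb c x) ^+ 2 + e) ->
  n%:R <= 1 + B.
Proof.
move=> V0 VB Vc; have B0 : 0 <= B by have := VB fset0; rewrite big_seq_fset0.
case: (posnP n) => [->|n0]; first by rewrite mulr0n addr_ge0.
have [h [h0 hq]] : exists g : nat -> 'I_n -> R[i],
    (forall i, (i < n.-1)%N -> lcomb (g i) x0 = 0) /\
    (forall i j, (i < n.-1)%N -> (j < n.-1)%N -> sesq (g i) (g j) = (i == j)%:R).
  by apply: gram_schmidt; rewrite prednK.
pose g (i : 'I_n.-1) := h i.
rewrite -{1}(prednK n0) -addn1 natrD addrC lerD2l.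
apply/ler_addgt0Pr => e e0.
have e1 : 0 < e / n%:R by rewrite divr_gt0 // ltr0n.
have Ai (i : 'I_n.-1) := Vc (g i) _ e1.
have {Ai}[A hA] := choice Ai.
(* The upper bound holds on large sets depending on the vector; the union is a common set for all
   [n - 1] of them, and errors [e / n] then add up to at most [e]. *)
pose Y := (\bigcup_(i <- enum 'I_n.-1) A i)%fset.
have gY i : 1 <= \sum_(x <- Y) V x * cmod (lcomb (g i) x) ^+ 2 + e / n%:R.
  apply: le_trans (hA i Y _); first by rewrite hq // eqxx.
  by apply: (@bigfcup_sup _ _ _ i) => //; rewrite mem_enum.
have : \sum_(i < n.-1) (1 : R) <= \sum_(i < n.-1)
   (\sum_(x <- Y) V x * cmod (lcomb (g i) x) ^+ 2 + e / n%:R).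
  by apply: ler_sum => i _; exact: gY.
rewrite sumr_const card_ord big_split /= sumr_const card_ord => /le_trans; apply.
apply: lerD.
  rewrite exchange_big /=; apply: le_trans (VB Y); apply: ler_sum => x _.
  rewrite -mulr_sumr ler_wpM2l // orthonormal_eval_bound //.
    by move=> i; apply: h0.
  by move=> i j; rewrite hq.
rewrite -(mulr_natr (e / n%:R)) -mulrA ler_piMr ?(ltW e0) //.
by rewrite mulrC ler_pdivrMr ?ltr0n // mul1r ler_nat leq_pred.
Qed.

End CountingLemma.

(** * Discrete Fourier analysis *)

Section RealInequalities.
Variable R : realType.

(** Mean value theorem based at [0] for either sign of [t], so that estimates along lines need no
    case distinction. *)
Lemma MVT0 (f df : R -> R) (t : R) :
  (forall s : R, `|s| <= `|t| -> is_derive s 1 f (df s)) ->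
  exists2 c, `|c| <= `|t| & f t - f 0 = df c * t.
Proof.
move=> fd.
have cont a b : (forall s, a <= s <= b -> `|s| <= `|t|) ->
    {within `[a, b], continuous f}.
  move=> ab; apply: derivable_within_continuous => s.
  rewrite in_itv /= => hs; have hd : is_derive s 1 f (df s) := fd s (ab s hs).
  exact: ex_derive.
have [t0|t0|->] := ltrgt0P t.
- have [||c] := @MVT _ f df 0 t t0.
  + move=> s; rewrite in_itv /= => /andP[s0 st]; apply: fd.
    by rewrite !ger0_norm // ltW.
  + by apply: cont => s /andP[s0 st]; rewrite !ger0_norm // ltW.
  + rewrite in_itv /= subr0 => /andP[c0 ct] E; exists c => //.
    by rewrite !ger0_norm // ltW.
- have [||c] := @MVT _ f df t 0 t0.
  + move=> s; rewrite in_itv /= => /andP[ts s0]; apply: fd.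
    by rewrite !ler0_norm ?lerN2 // ltW.
  + by apply: cont => s /andP[ts s0]; rewrite !ler0_norm ?lerN2 // ltW.
  + rewrite in_itv /= sub0r => /andP[tc c0] E; exists c.
      by rewrite !ler0_norm ?lerN2 // ltW.
    by rewrite -opprB E mulrN opprK.
- by exists 0; rewrite ?normr0 // subrr mulr0.
Qed.

Lemma norm_sin_le (t : R) : `|sin t| <= `|t|.
Proof.
have [c _] := @MVT0 sin cos t (fun s _ => is_derive_sin s).
rewrite sin0 subr0 => ->; rewrite normrM ler_piMl //.
by rewrite ler_norml cos_geN1 cos_le1.
Qed.

Lemma cauchy_schwarz_sum (I : finType) (a b : I -> R) :
  (\sum_i a i * b i) ^+ 2 <= (\sum_i a i ^+ 2) * (\sum_i b i ^+ 2).
Proof.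
have gen (u v : R) : \sum_i (a i * u - b i * v) ^+ 2 =
    u ^+ 2 * (\sum_i a i ^+ 2) - (2 * u * v) * (\sum_i a i * b i)
    + v ^+ 2 * (\sum_i b i ^+ 2).
  rewrite !mulr_sumr -sumrB -big_split /=.
  by apply: eq_bigr => i _; ring.
set P := \sum_i a i * b i; set S := \sum_i b i ^+ 2.
have : 0 <= S by apply: sumr_ge0 => i _; exact: sqr_ge0.
rewrite le_eqVlt => /orP[/eqP S0|S0].
  have b0 i : b i = 0.
    apply/eqP; rewrite -sqrf_eq0 eq_le sqr_ge0 andbT S0 /S (bigD1 i) //=.
    by rewrite lerDl sumr_ge0 // => j _; exact: sqr_ge0.
  by rewrite -S0 mulr0 /P big1 ?expr0n // => i _; rewrite b0 mulr0.
(* Expands to [S * (S * sum a^2 - P^2)]. *)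
have : 0 <= \sum_i (a i * S - b i * P) ^+ 2.
  by apply: sumr_ge0 => i _; exact: sqr_ge0.
rewrite gen -/P -/S => h; rewrite -(ler_pM2l S0); lra.
Qed.

(* Young's inequality with exponents [1/b] and [1/(1-b)] yields [t^b <= b t + 1 - b]. *)
Lemma powR_concave_incr (b : R) (j : nat) : 0 < b -> b < 1 ->
  b * (j.+1%:R) `^ (b - 1) <= (j.+1%:R) `^ b - (j%:R) `^ b.
Proof.
move=> b0 b1; set n : R := j.+1%:R; have n0 : 0 < n by rewrite ltr0n.
have j0 : 0 <= j%:R :> R by rewrite ler0n.
have x0 : 0 <= j%:R / n by rewrite divr_ge0 // ltW.
have hp : 0 < b^-1 by rewrite invr_gt0.
have hq : 0 < (1 - b)^-1 by rewrite invr_gt0 subr_gt0.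
have hpq : b^-1^-1 + (1 - b)^-1^-1 = 1 by rewrite !invrK addrC subrK.
have := conjugate_powR (powR_ge0 (j%:R / n) b) ler01 hp hq hpq.
rewrite -powRrM mulfV ?gt_eqF // powRr1 // powR1 mulr1 !invrK mul1r.
have n0' : 0 <= n by rewrite ltW.
have E : j%:R `^ b = n `^ b * (j%:R / n) `^ b.
  by rewrite -powRM // mulrCA mulfV ?mulr1 // gt_eqF.
rewrite E -(mulr_powRB1 n0' b0) => h.
have P0 : 0 <= n `^ (b - 1) by exact: powR_ge0.
have -> : b * n `^ (b - 1) = n * n `^ (b - 1) * (b / n).
  by field; rewrite gt_eqF.
rewrite -[X in _ <= X - _]mulr1 -mulrBr ler_wpM2l ?mulr_ge0 //.
have -> : b / n = b - j%:R / n * b.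
  by rewrite /n -natr1; field; rewrite natr1 gt_eqF.
move: h; move: (_ * b) (_ `^ b) => y X h; lra.
Qed.

(** Discrete form of [int_0^M t^(b-1) dt = M^b / b]: the concavity increments telescope. *)
Lemma sum_powR_le (b : R) (M : nat) : 0 < b -> b < 1 ->
  \sum_(0 <= j < M) (j.+1%:R) `^ (b - 1) <= (M%:R) `^ b / b.
Proof.
move=> b0 b1; rewrite ler_pdivlMr // mulr_suml.
apply: le_trans (_ : \sum_(0 <= j < M) ((j.+1%:R) `^ b - (j%:R) `^ b) <= _).
  by apply: ler_sum => j _; rewrite mulrC powR_concave_incr.
by rewrite telescope_sumr // powR0 ?subr0 // gt_eqF.
Qed.

(** Integrability of [|t|^(b-1)] at the origin, on a grid: the mean over the grid is at most
    [1 / b], uniformly in [M]. By symmetry both halves equal a sum over the odd multiples of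
    [pi / M.*2]. *)
Lemma grid_sum_bound (b : R) (M : nat) : (0 < M)%N -> 0 < b -> b < 1 ->
  \sum_(k < M.*2) `|pi * ((2 * k + 1)%:R - M.*2%:R) / M.*2%:R| `^ (b - 1)
    <= M.*2%:R / b.
Proof.
move=> M0 b0 b1; pose G (x : R) := `|pi * x / M.*2%:R| `^ (b - 1).
have Mp : 0 < M%:R :> R by rewrite ltr0n.
have GN x : G (- x) = G x by rewrite /G mulrN mulNr normrN.
rewrite -(big_mkord xpredT (fun k => G ((2 * k + 1)%:R - M.*2%:R))).
have MM : (M <= M.*2)%N by rewrite -addnn leq_addr.
rewrite (big_cat_nat (n := M)) //= big_nat_rev /= add0n.
have -> : \sum_(0 <= i < M) G ((2 * (M - i.+1) + 1)%:R - M.*2%:R) =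
    \sum_(0 <= i < M) G (2 * i + 1)%:R.
  rewrite !big_nat; apply: eq_bigr => i /= iM; rewrite -GN; congr G.
  rewrite opprB -natrB; last by lia.
  by congr (_%:R); lia.
have -> : \sum_(M <= i < M.*2) G ((2 * i + 1)%:R - M.*2%:R) =
    \sum_(0 <= i < M) G (2 * i + 1)%:R.
  rewrite -{1}[M]add0n big_addn -addnn addnK; apply: eq_bigr => i _.
  by rewrite -natrB; [congr (G _%:R); lia|lia].
have h : \sum_(0 <= i < M) G (2 * i + 1)%:R <= M%:R / b.
  apply: le_trans (_ : \sum_(0 <= i < M) (M%:R `^ (1 - b) * i.+1%:R `^ (b - 1)) <= _).
    apply: ler_sum => i _.
    have -> : M%:R `^ (1 - b) * i.+1%:R `^ (b - 1) = (i.+1%:R / M%:R) `^ (b - 1) :> R.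
      rewrite powRM ?invr_ge0 // -[(M%:R^-1)]powR_inv1 // -powRrM mulN1r opprB.
      by rewrite mulrC.
    rewrite /G.
    have y0 : 0 < i.+1%:R / M%:R :> R by rewrite divr_gt0 // ltr0n.
    set z := `| _ |.
    (* Follows from [pi >= 2] and [2 (2 i + 1) >= 2 (i + 1)]; the negative exponent then reverses
       the inequality. *)
    have yz : i.+1%:R / M%:R <= z.
      rewrite /z ger0_norm; last first.
        by rewrite divr_ge0 ?mulr_ge0 ?pi_ge0 ?ler0n.
      rewrite -muln2 natrM invfM mulrA mulrAC ler_pM2r ?invr_gt0 //.
      rewrite ler_pdivlMr // -natrM.
      apply: le_trans (_ : (2 * (2 * i + 1))%:R <= _); first by rewrite ler_nat; lia.
      by rewrite natrM ler_wpM2r ?ler0n // pi_ge2.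
    rewrite -(opprB 1) !powRN lef_pV2 ?posrE ?powR_gt0 //; last exact: lt_le_trans yz.
    apply: ge0_ler_powR => //; rewrite ?nnegrE ?subr_ge0 ?(ltW b1) ?(ltW y0) //.
    exact: le_trans (ltW y0) yz.
  rewrite -mulr_sumr.
  apply: le_trans (ler_wpM2l (powR_ge0 _ _) (sum_powR_le M b0 b1)) _.
  by rewrite mulrA -powRD ?subrK ?powRr1 ?ler0n // oner_eq0.
apply: le_trans (lerD h h) _.
by rewrite -mulrDl -natrD addnn.
Qed.

End RealInequalities.

(** * Characters and their sums over the shifted grid *)

Section Characters.
Variable R : realType.
Implicit Types s t : R.

Lemma expiD s t : expi (s + t) = expi s * expi t.
Proof. by rewrite /expi cosD sinD; congr Complex; rewrite addrC. Qed.

Lemma expi0 : expi (0 : R) = 1.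
Proof. by rewrite /expi cos0 sin0. Qed.

Lemma expiN t : expi (- t) = (expi t)^*%C.
Proof. by rewrite /expi cosN sinN. Qed.

Lemma cmod_expi t : cmod (expi t) = 1.
Proof. by rewrite /cmod /= cos2Dsin2 sqrtr1. Qed.

Lemma expi_sum (I : Type) (r : seq I) (P : pred I) (F : I -> R) :
  expi (\sum_(i <- r | P i) F i) = \prod_(i <- r | P i) expi (F i).
Proof. by apply: (big_morph _ expiD expi0). Qed.

Lemma expiMn t n : expi (n%:R * t) = expi t ^+ n.
Proof.
elim: n => [|n IH]; first by rewrite mul0r expi0 expr0.
by rewrite exprS -IH -expiD -natr1 mulrDl mul1r addrC.
Qed.

Lemma expi_2pi_int (z : int) : expi (z%:~R * (2 * pi) : R) = 1.
Proof.
have e1 : expi (2 * pi : R) = 1 by rewrite mulr_natl /expi cos2pi sin2pi.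
case: z => n; first by rewrite -pmulrn expiMn e1 expr1n.
by rewrite NegzE mulrNz mulNr expiN -pmulrn expiMn e1 expr1n conjc1.
Qed.

Lemma sqr_cmod_expiB1 t : cmod (expi t - 1) ^+ 2 = 4 * sin (t / 2) ^+ 2.
Proof.
have {1}-> : t = (t / 2) *+ 2 by rewrite -mulr_natr divfK ?pnatr_eq0.
rewrite sqr_cmod ReD ReN ImD ImN /= oppr0 addr0 cos_mulr2n sin_mulr2n.
have := cos2Dsin2 (t / 2); move: (cos _) (sin _) => u v uv.
have -> : (u * v *+ 2) ^+ 2 = 4 * u ^+ 2 * v ^+ 2 by ring.
have -> : u ^+ 2 = 1 - v ^+ 2 by rewrite -uv addrK.
by ring.
Qed.

(** Interpolation between the bound [4], used for [|t| > 1] where [a >= 0] gives [|t|^a >= 1], and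
    the bound by [|t|^2], used for [|t| <= 1] where [a <= 2] gives [|t|^2 <= |t|^a]. *)
Lemma sqr_cmod_expiB1_le t (a : R) : 0 <= a -> a <= 2 ->
  cmod (expi t - 1) ^+ 2 <= 4 * `|t| `^ a.
Proof.
move=> a0 a2; rewrite sqr_cmod_expiB1 ler_pM2l //.
case: (eqVneq t 0) => [->|t0].
  by rewrite mul0r sin0 expr0n /= powR_ge0.
rewrite -normr_gt0 in t0.
have [t1|/ltW t1] := leP `|t| 1; last first.
  apply: le_trans (_ : 1 <= _).
    by rewrite sin2cos2 lerBlDr lerDl sqr_ge0.
  by rewrite -[1](powRr0 `|t|) ler_powR.
apply: le_trans (_ : `|t| ^+ 2 <= _).
  rewrite -[X in X <= _]real_normK ?num_real // ler_pXn2r ?nnegrE //.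
  apply: le_trans (norm_sin_le _) _; rewrite normrM ler_piMr //.
  by rewrite ger0_norm ?invr_ge0 // invf_le1 // ler1n.
rewrite -powR_mulrn //; apply: ger_powR => //.
by rewrite t0.
Qed.

(** Equality would force [sin (pi z / N) = 0], while [0 < pi |z| / N < pi]. *)
Lemma expi_eq1 (z : int) (N : nat) : z != 0 -> (`|z| < N)%N ->
  expi (z%:~R * (2 * pi / N%:R) : R) != 1.
Proof.
move=> z0 zN; have N0 : 0 < N%:R :> R by rewrite ltr0n (leq_ltn_trans _ zN).
rewrite -subr_eq0 -cmod_eq0 -sqrf_eq0 sqr_cmod_expiB1 mulf_eq0 pnatr_eq0 /=.
rewrite sqrf_eq0 -normr_eq0.
have -> : z%:~R * (2 * pi / N%:R) / 2 = z%:~R * (pi / N%:R) :> R.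
  by field; rewrite gt_eqF.
set u := z%:~R * _.
have -> : `|sin u| = `|sin `|u| |.
  by have [_|_] := ger0P u; rewrite // sinN normrN.
rewrite normr_eq0 gt_eqF // sin_gt0_pi // normr_gt0 /u mulf_neq0 ?intr_eq0 //=; last first.
  by rewrite mulf_neq0 ?invr_eq0 ?gt_eqF // pi_gt0.
rewrite normrM (ger0_norm (_ : 0 <= pi / N%:R)) ?divr_ge0 ?pi_ge0 //.
rewrite mulrCA gtr_pMr ?pi_gt0 // ltr_pdivrMr // mul1r.
by rewrite -intr_norm pmulrn ltr_int -abszE ltz_nat.
Qed.

(** The centre [al] and the half-step offset factor out as a phase, and what remains is the
    geometric sum of a nontrivial [N]-th root of unity. Hence orthogonality holds for a grid around
    any point. *)
Lemma sum_expi_grid (z : int) (N : nat) (al : R) : z != 0 -> (`|z| < N)%N ->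
  \sum_(k < N) expi (z%:~R * (al + pi * ((2 * k + 1)%:R - N%:R) / N%:R)) = 0.
Proof.
move=> z0 zN; have N0 : 0 < N%:R :> R by rewrite ltr0n (leq_ltn_trans _ zN).
pose om : R[i] := expi (z%:~R * (2 * pi / N%:R)).
have -> : \sum_(k < N) expi (z%:~R * (al + pi * ((2 * k + 1)%:R - N%:R) / N%:R)) =
    expi (z%:~R * (al + pi * (1 - N%:R) / N%:R)) * \sum_(k < N) om ^+ k.
  rewrite mulr_sumr; apply: eq_bigr => k _; rewrite /om -expiMn -expiD.
  by congr expi; rewrite natrD natrM; field; rewrite gt_eqF.
apply/eqP; rewrite mulf_eq0; apply/orP; right.
have : om ^+ N - 1 = 0.
  rewrite /om -expiMn mulrCA [N%:R * _]mulrC divfK ?gt_eqF // expi_2pi_int.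
  by rewrite subrr.
move/eqP; rewrite subrX1 mulf_eq0 subr_eq0.
by rewrite (negbTE (expi_eq1 z0 zN)).
Qed.

End Characters.

Section DotProduct.
Variables (R : realType) (d : nat).
Implicit Types (x y : Zd d) (p q : 'rV[R]_d).

Lemma dotpDl x y p : dotp (x + y) p = dotp x p + dotp y p.
Proof.
by rewrite /dotp -big_split; apply: eq_bigr => i _; rewrite ffunE rmorphD mulrDl.
Qed.

Lemma dotpNl x p : dotp (- x) p = - dotp x p.
Proof.
by rewrite /dotp -sumrN; apply: eq_bigr => i _; rewrite ffunE rmorphN mulNr.
Qed.

Lemma dotp0l p : dotp 0 p = 0.
Proof. by rewrite /dotp big1 // => i _; rewrite ffunE mul0r. Qed.

Lemma dotpDr x p q : dotp x (p + q) = dotp x p + dotp x q.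
Proof. by rewrite /dotp -big_split; apply: eq_bigr => i _; rewrite mxE mulrDr. Qed.

Lemma dotp_le x q : `|dotp x q| <= znorm R x * Num.sqrt (\sum_i q ord0 i ^+ 2).
Proof.
rewrite -sqrtr_sqr /znorm -sqrtrM; last by apply: sumr_ge0 => i _; exact: sqr_ge0.
by rewrite ler_sqrt ?cauchy_schwarz_sum // mulr_ge0 ?sumr_ge0 // => i _; exact: sqr_ge0.
Qed.

End DotProduct.

(** * The finite Fourier transform on the grid *)

Section DiscreteFourier.
Variables (R : realType) (d N : nat) (p1 : 'rV[R]_d).
Implicit Types (k : {ffun 'I_d -> 'I_N}) (A B : {fset Zd d}) (f : Zd d -> R[i]).

(* The coordinates are the odd multiples of [pi / N] in [(-pi, pi)] when [N] is even. *)
Definition qgrid k : 'rV[R]_d :=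
  \row_i (pi * ((2 * k i + 1)%:R - N%:R) / N%:R).
Definition pgrid k := p1 + qgrid k.

Let D : R[i] := (N ^ d)%:R.

(** The sum factors over the coordinates, and a nonzero coordinate of [z] makes its factor
    vanish. *)
Lemma dft_orth (z : Zd d) : (forall i, (`|z i| < N)%N) ->
  \sum_k expi (dotp z (pgrid k)) = D * (z == 0)%:R.
Proof.
move=> zN.
pose F (i : 'I_d) (j : 'I_N) :=
  expi ((z i)%:~R * (p1 ord0 i + pi * ((2 * j + 1)%:R - N%:R) / N%:R) : R).
have -> : \sum_k expi (dotp z (pgrid k)) = \prod_i \sum_j F i j.
  rewrite bigA_distr_bigA; apply: eq_bigr => k _; rewrite /dotp expi_sum.
  by apply: eq_bigr => i _; rewrite !mxE.
have [z0|z0] := eqVneq z 0.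
  rewrite mulr1 /D natrX -[in RHS](card_ord d) -prodr_const.
  apply: eq_big => // i _; rewrite -[in RHS](card_ord N) -sumr_const.
  by apply: eq_big => // j _; rewrite /F z0 ffunE mul0r expi0.
have [i zi] : exists i, z i != 0.
  apply/existsP; apply: contraNT z0; rewrite negb_exists => /forallP h.
  by apply/eqP/ffunP => i; rewrite ffunE; apply/eqP; have := h i; rewrite negbK.
by rewrite mulr0 (bigD1 i) //= sum_expi_grid // mul0r.
Qed.

(** Unnormalised, so inversion carries the number [D] of grid points. With this sign of the exponent
    [h0] becomes multiplication by the symbol at [p]. *)
Definition dft A f k : R[i] := \sum_(x <- A) f x * expi (- dotp x (pgrid k)).

Lemma dft_inv A f (z : Zd d) : (forall x, x \in A -> forall i, (`|(z - x)%R i| < N)%N) ->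
  \sum_k dft A f k * expi (dotp z (pgrid k)) = D * \sum_(x <- A) f x * (x == z)%:R.
Proof.
move=> zN; under eq_bigr do rewrite /dft mulr_suml.
rewrite exchange_big mulr_sumr !big_seq /=; apply: eq_bigr => x xA.
under eq_bigr do rewrite -mulrA -expiD addrC -dotpNl -dotpDl.
by rewrite -mulr_sumr (dft_orth (zN x xA)) subr_eq0 (eq_sym z) mulrCA.
Qed.

Lemma dft_inv_in A f (z : Zd d) : (forall x, x \in A -> forall i, (`|(z - x)%R i| < N)%N) ->
  z \in A -> \sum_k dft A f k * expi (dotp z (pgrid k)) = D * f z.
Proof.
move=> zN zA; rewrite dft_inv // (bigD1_seq z) ?fset_uniq //= eqxx mulr1.
by rewrite big1 ?addr0 // => x /negbTE ->; rewrite mulr0.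
Qed.

(** Inversion at the origin says that the transform has zero sum when [f 0 = 0]; any phase
    independent of [k] may therefore be subtracted. *)
Lemma dft_eval A f (x : Zd d) : x \in A -> f 0 = 0 ->
  (forall y, y \in A -> forall i, (`|(x - y)%R i| < N)%N && (`|y i| < N)%N) ->
  \sum_k dft A f k * (expi (dotp x (pgrid k)) - expi (dotp x p1)) = D * f x.
Proof.
move=> xA f0 xN; under eq_bigr do rewrite mulrBr.
rewrite sumrB -mulr_suml dft_inv_in //; last by move=> y yA i; case/andP: (xN y yA i).
have -> : \sum_k dft A f k = \sum_k dft A f k * expi (dotp 0 (pgrid k)).
  by apply: eq_bigr => k _; rewrite dotp0l expi0 mulr1.
rewrite dft_inv => [|y yA i]; last first.
  by case/andP: (xN y yA i) => _; rewrite sub0r ffunE abszN.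
rewrite big1 ?mulr0 ?mul0r ?subr0 // => y _.
by case: eqP => [->|_]; rewrite ?f0 ?mul0r ?mulr0.
Qed.

(** The squared modulus of the transform has the autocorrelation of [f] as its coefficients: [z = 0]
    is Plancherel, and summing with weights [eh z] gives [hform]. *)
Lemma dft_quad A f (z : Zd d) :
  (forall x y, x \in A -> y \in A -> forall i, (`|(z - (y - x))%R i| < N)%N) ->
  \sum_k (cmod (dft A f k) ^+ 2)%:C%C * expi (dotp z (pgrid k)) =
  D * \sum_(x <- A) \sum_(y <- A) (f x)^*%C * f y * (y - x == z)%:R.
Proof.
move=> zN.
transitivity (\sum_k \sum_(x <- A) \sum_(y <- A)
   (f x)^*%C * f y * expi (dotp (z - (y - x)) (pgrid k))).
  apply: eq_bigr => k _; rewrite -mulJc /dft conjc_sum mulr_suml mulr_suml.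
  apply: eq_bigr => x _; rewrite mulr_sumr mulr_suml; apply: eq_bigr => y _.
  rewrite conjcM -expiN opprK opprB !dotpDl dotpNl !expiD; ring.
rewrite exchange_big mulr_sumr !big_seq /=; apply: eq_bigr => x xA.
rewrite exchange_big mulr_sumr !big_seq /=; apply: eq_bigr => y yA.
by rewrite -mulr_sumr (dft_orth (zN x y xA yA)) subr_eq0 (eq_sym z) mulrCA.
Qed.

End DiscreteFourier.

(** * Uniform approximation of the symbol by trigonometric polynomials *)

Section Symbol.
Variables (R : realType) (d : nat) (eh : Zd d -> R[i]).
Hypothesis eh1 : abs_summable eh.

Definition efun_part (B : {fset Zd d}) (p : 'rV[R]_d) : R :=
  \sum_(z <- B) complex.Re (eh z * expi (dotp z p)).

(** Uniformity in [p] holds because [B0] is chosen from the tail of [|eh|] alone. The auxiliary set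
    [A] depends on [p] but only contributes the arbitrary error [e']. *)
Lemma efun_approx (e : R) : 0 < e ->
  exists B0 : {fset Zd d}, forall B, (B0 `<=` B)%fset ->
    forall p, `|efun eh p - efun_part B p| <= e.
Proof.
move=> e0; have [B0 hB0] := esum_tail (fun=> cmod_ge0 _) eh1 e0.
exists B0 => B BB p; apply/ler_addgt0Pr => e' e'0.
have term_le z : `|complex.Re (eh z * expi (dotp z p))| <= cmod (eh z).
  by rewrite (le_trans (cmod_Re _)) // cmodM cmod_expi mulr1.
have [|A hA] := @rsum_approx _ _ (fun z => complex.Re (eh z * expi (dotp z p))) e' _ e'0.
  by apply: le_lt_trans eh1; apply: le_esum => x _; rewrite lee_fin.
have := hA (B `|` A)%fset (fsubsetUr _ _).
rewrite (@sum_fsetU_disj _ _ _ B) ?fsubsetUl // opprD addrA => h.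
rewrite -[X in `|X|](subrK (\sum_(z <- ((B `|` A) `\` B)%fset)
  complex.Re (eh z * expi (dotp z p)))).
rewrite (le_trans (ler_normD _ _)) // addrC lerD //.
apply: le_trans (ler_norm_sum _ _ _) _.
apply: le_trans (ler_sum _ (fun z _ => term_le z)) _; apply: hB0.
apply/fdisjointP => z zB; rewrite !inE negb_and negbK.
by rewrite (fsubsetP BB).
Qed.

End Symbol.

Lemma absz_coordB d (n : nat) (u v : Zd d) i : (`|u i| < n)%N -> (`|v i| < n)%N ->
  (`|(u - v)%R i| < (n * 2).+1.*2)%N.
Proof. by rewrite !ffunE; move: (u i) (v i) => a b; rewrite -muln2; lia. Qed.

(** * Pointwise bound for truncations vanishing at the origin *)

Section PointwiseBound.
Variables (R : realType) (d : nat) (eh : Zd d -> R[i]) (p1 : 'rV[R]_d) (E c g : R).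
Hypothesis eh1 : abs_summable eh.
Hypothesis d0 : (0 < d)%N.
Hypothesis c0 : 0 < c.
Hypothesis quad : forall q : 'rV[R]_d, (forall i, `|q ord0 i| <= pi) ->
  c * \sum_i q ord0 i ^+ 2 <= E - efun eh (p1 + q).
Hypothesis g0 : 0 < g.
Hypothesis gd : g < d%:R.
Let a : R := 2 - d%:R + g.
Hypothesis a0 : 0 <= a.
Implicit Types (A B : {fset Zd d}) (f : Zd d -> R[i]).

Let b : R := g / d%:R.
Let dR0 : 0 < d%:R :> R. Proof. by rewrite ltr0n. Qed.
Let b0 : 0 < b. Proof. by rewrite divr_gt0. Qed.
Let b1 : b < 1. Proof. by rewrite ltr_pdivrMr // mul1r. Qed.
Let a2 : a <= 2. Proof. by rewrite /a; move: gd; lra. Qed.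

(** The numerator is an odd minus an even integer, hence nonzero, and it is less than [M.*2] in
    absolute value. *)
Lemma qgrid_bounds M (k : {ffun 'I_d -> 'I_M.*2}) i :
  0 < `|@qgrid R _ _ k ord0 i| <= pi.
Proof.
have M0 : (0 < M.*2)%N by apply: leq_ltn_trans (ltn_ord (k i)).
have N0 : 0 < M.*2%:R :> R by rewrite ltr0n.
rewrite mxE; move: (k i) => j; clear k i; clear -M0 N0.
rewrite !normrM (ger0_norm (pi_ge0 _)) normfV (ger0_norm (ltW N0)).
have -> : (2 * j + 1)%:R - M.*2%:R = (Posz (2 * j + 1) - Posz M.*2)%:~R :> R.
  by rewrite rmorphB.
rewrite -intr_norm; apply/andP; split.
  rewrite divr_gt0 // mulr_gt0 ?pi_gt0 // ltr0z normr_gt0; lia.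
rewrite ler_pdivrMr // ler_pM2l ?pi_gt0 // pmulrn ler_int.
by have := ltn_ord j; lia.
Qed.

(* [|q|^(a-2)] is bounded by a product over the coordinates since [a - 2 = d (b - 1)] is
   negative; this reduces the sum over the grid to a one-dimensional one. *)
Lemma phase_ratio_le M (k : {ffun 'I_d -> 'I_M.*2}) (x : Zd d) :
  cmod (expi (dotp x (@qgrid R _ _ k)) - 1) ^+ 2 /
    (\sum_i (@qgrid R _ _ k) ord0 i ^+ 2) <=
  4 * znorm R x `^ a * \prod_i `|(@qgrid R _ _ k) ord0 i| `^ (b - 1).
Proof.
set q := @qgrid R _ _ k; set rho := \sum_i q ord0 i ^+ 2; pose r := Num.sqrt rho.
have q0 i : 0 < `|q ord0 i| by have /andP[] := qgrid_bounds k i.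
have rho_ge i : q ord0 i ^+ 2 <= rho.
  rewrite /rho (bigD1 i) //= lerDl sumr_ge0 // => j _; exact: sqr_ge0.
have rho0 : 0 < rho.
  apply: lt_le_trans (rho_ge (Ordinal d0)).
  by rewrite -real_normK ?num_real // exprn_gt0.
have r0 : 0 < r by rewrite sqrtr_gt0.
have rq i : `|q ord0 i| <= r by rewrite -sqrtr_sqr ler_sqrt // ltW.
have zn0 : 0 <= znorm R x by exact: sqrtr_ge0.
have h1 : cmod (expi (dotp x q) - 1) ^+ 2 <= 4 * (znorm R x `^ a * r `^ a).
  apply: le_trans (sqr_cmod_expiB1_le _ a0 a2) _.
  rewrite ler_pM2l // -powRM ?(ltW r0) //.
  by apply: ge0_ler_powR => //; rewrite ?nnegrE ?mulr_ge0 ?(ltW r0) ?dotp_le.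
have h2 : r `^ a / rho = r `^ (a - 2).
  rewrite powRB ?(gt_eqF r0) ?implybT // (_ : rho = r `^ 2) //.
  by rewrite powR_mulrn ?(ltW r0) // sqr_sqrtr // ltW.
have h3 : r `^ (a - 2) <= \prod_i `|q ord0 i| `^ (b - 1).
  have -> : r `^ (a - 2) = \prod_(i < d) r `^ (b - 1).
    rewrite prodr_const card_ord -powR_mulrn ?powR_ge0 // -powRrM; congr powR.
    by rewrite /a /b; field; rewrite gt_eqF.
  apply: ler_prod => i _; rewrite powR_ge0 /=.
  rewrite -(opprB 1) !powRN lef_pV2 ?posrE ?powR_gt0 //.
  by apply: ge0_ler_powR; rewrite ?nnegrE ?subr_ge0 ?(ltW b1) ?(ltW r0) ?rq.
apply: le_trans (ler_wpM2r _ h1) _; first by rewrite invr_ge0 ltW.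
rewrite [4 * _]mulrA -[X in X <= _]mulrA h2 ler_wpM2l //.
by rewrite mulr_ge0 ?powR_ge0.
Qed.

(** After division by the number of grid points the bound is uniform in [M]; it replaces the
    integral of [|e^{ixq} - 1|^2 / |q|^2]. *)
Lemma phase_sum_le M (x : Zd d) : (0 < M)%N ->
  \sum_(k : {ffun 'I_d -> 'I_M.*2})
    cmod (expi (dotp x (@qgrid R _ _ k)) - 1) ^+ 2 /
      (\sum_i (@qgrid R _ _ k) ord0 i ^+ 2) <=
  4 * znorm R x `^ a * (M.*2%:R / b) ^+ d.
Proof.
move=> M0; apply: le_trans (ler_sum _ (fun k _ => phase_ratio_le k x)) _.
rewrite -mulr_sumr ler_wpM2l ?mulr_ge0 ?powR_ge0 //.
pose F (i : 'I_d) (j : 'I_M.*2) : R :=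
  `|pi * ((2 * j + 1)%:R - M.*2%:R) / M.*2%:R| `^ (b - 1).
have -> : \sum_(k : {ffun 'I_d -> 'I_M.*2})
    \prod_i `|(@qgrid R _ _ k) ord0 i| `^ (b - 1) = \prod_i \sum_j F i j.
  rewrite bigA_distr_bigA; apply: eq_bigr => k _; apply: eq_bigr => i _.
  by rewrite mxE.
have -> : (M.*2%:R / b) ^+ d = \prod_(i < d) (M.*2%:R / b).
  by rewrite prodr_const card_ord.
apply: ler_prod => i _; apply/andP; split.
  by apply: sumr_ge0 => j _; exact: powR_ge0.
exact: grid_sum_bound.
Qed.

Lemma fset_coord_bound (S : {fset Zd d}) :
  exists N0 : nat, forall x, x \in S -> forall i, (`|x i| < N0)%N.
Proof.
exists (\sum_(x <- S) \sum_i `|x i|).+1 => x xS i; rewrite ltnS.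
by rewrite (bigD1_seq x) ?fset_uniq //= (bigD1 i) //= -addnA leq_addr.
Qed.

(** The second condition puts every difference of points of [A] into [B], so that no entry of
    [hform] is missing; the first excludes aliasing. *)
Lemma dft_energy A B f N : (0 < N)%N ->
  (forall x y z, x \in A -> y \in A -> z \in B ->
     forall i, (`|(z - (y - x))%R i| < N)%N) ->
  (forall x y, x \in A -> y \in A -> y - x \in B) ->
  \sum_(k : {ffun 'I_d -> 'I_N}) cmod (dft p1 A f k) ^+ 2 * efun_part eh B (pgrid p1 k) =
  (N ^ d)%:R * complex.Re (hform eh f f A).
Proof.
move=> N0 hN hB.
pose S := \sum_(k : {ffun 'I_d -> 'I_N}) \sum_(z <- B)
  (cmod (dft p1 A f k) ^+ 2)%:C%C * (eh z * expi (dotp z (pgrid p1 k))).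
transitivity (complex.Re S).
  rewrite Re_sum; apply: eq_bigr => k _; rewrite Re_sum mulr_sumr.
  by apply: eq_bigr => z _; rewrite ReZ.
have -> : S = (N ^ d)%:R%:C%C * hform eh f f A.
  rewrite /S exchange_big /=.
  transitivity (\sum_(z <- B) eh z * ((N ^ d)%:R *
     \sum_(x <- A) \sum_(y <- A) (f x)^*%C * f y * (y - x == z)%:R)).
    rewrite !big_seq; apply: eq_bigr => z zB.
    rewrite -(dft_quad p1 f (fun x y xA yA => hN x y z xA yA zB)) mulr_sumr.
    by apply: eq_bigr => k _; rewrite mulrCA.
  under eq_bigr do rewrite mulrCA mulr_sumr.
  rewrite -mulr_sumr rmorph_nat; congr (_ * _); rewrite exchange_big /hform !big_seq.
  apply: eq_bigr => x xA; under eq_bigr do rewrite mulr_sumr.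
  rewrite exchange_big !big_seq; apply: eq_bigr => y yA.
  rewrite (bigD1_seq (y - x)) ?fset_uniq ?hB //= eqxx mulr1 big1 ?addr0.
    by rewrite /hkernel /=; ring.
  by move=> z; rewrite eq_sym => /negbTE ->; rewrite !mulr0.
by rewrite ReZ.
Qed.

Lemma dft_plancherel A f N : (0 < N)%N ->
  (forall x y, x \in A -> y \in A -> forall i, (`|(y - x)%R i| < N)%N) ->
  \sum_(k : {ffun 'I_d -> 'I_N}) cmod (dft p1 A f k) ^+ 2 =
  (N ^ d)%:R * \sum_(x <- A) cmod (f x) ^+ 2.
Proof.
move=> N0 hN; apply: complexI; rewrite rmorphM /= rmorph_nat !rmorph_sum /=.
have hN0 x y : x \in A -> y \in A -> forall i, (`|((0 : Zd d) - (y - x))%R i| < N)%N.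
  by move=> xA yA i; rewrite sub0r ffunE abszN hN.
transitivity (\sum_(k : {ffun 'I_d -> 'I_N})
    (cmod (dft p1 A f k) ^+ 2)%:C%C * expi (dotp 0 (pgrid p1 k))).
  by apply: eq_bigr => k _; rewrite dotp0l expi0 mulr1.
rewrite (dft_quad p1 f hN0); congr (_ * _).
rewrite !big_seq; apply: eq_bigr => x xA.
rewrite (bigD1_seq x) ?fset_uniq //= subrr eqxx mulr1 big1 ?addr0 ?mulJc //.
by move=> y yx; rewrite subr_eq0 (negbTE yx) mulr0.
Qed.

(** The factor [4] comes from the phase estimate, [1 / c] from the quadratic lower bound, and
    [1 / b^d = (d / g)^d] from the [d] one-dimensional grid sums. *)
Definition pointwise_const := 4 / c / b ^+ d.

Lemma pointwise_const_gt0 : 0 < pointwise_const.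
Proof. by rewrite divr_gt0 ?exprn_gt0 // divr_gt0. Qed.

(* [e] is replaced by a partial sum of its Fourier series, uniformly close to it; since the
   resulting error is independent of the grid, it disappears in the end. *)
Lemma pointwise_bound A f x : f 0 = 0 -> x \in A ->
  cmod (f x) ^+ 2 <= pointwise_const * znorm R x `^ a *
    (E * (\sum_(x <- A) cmod (f x) ^+ 2) - complex.Re (hform eh f f A)).
Proof.
move=> f0 xA; set S := \sum_(x <- A) _; set H := complex.Re _.
set K := pointwise_const * _.
have S0 : 0 <= S by apply: sumr_ge0 => y _; exact: sqr_ge0.
have K0 : 0 <= K by rewrite mulr_ge0 ?powR_ge0 // ltW // pointwise_const_gt0.
suff h e : 0 < e -> cmod (f x) ^+ 2 <= K * (E * S - H + e * S).
  apply/ler_addgt0Pr => e e0.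
  have KS : 0 <= K * S by exact: mulr_ge0.
  have KS0 : 0 < K * S + 1 by apply: ltr_wpDl.
  apply: le_trans (h _ (divr_gt0 e0 KS0)) _.
  have -> : K * (E * S - H + e / (K * S + 1) * S) =
      K * (E * S - H) + e * (K * S / (K * S + 1)).
    by field; rewrite gt_eqF.
  rewrite lerD2l ler_piMr ?(ltW e0) //.
  by rewrite ler_pdivrMr // mul1r lerDl.
move=> e0; have [B0 hB0] := efun_approx eh1 e0.
(* [B0] makes the partial symbol close to [efun]; the differences of [A] make [dft_energy] exact. *)
pose B := (B0 `|` [fset (p.2 - p.1)%R | p in (A `*` A)%fset])%fset.
have hB u v : u \in A -> v \in A -> v - u \in B.
  move=> uA vA; rewrite inE; apply/orP; right; apply/imfsetP.
  by exists (u, v) => //; rewrite in_fsetM uA.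
have [N0 hN0] := fset_coord_bound (A `|` B)%fset.
(* [N] is even and exceeds [2 * N0], hence also every coordinate of a difference of vectors from [A]
   and [B]. *)
pose M := (N0 * 2).+1; pose N := M.*2; have M0 : (0 < M)%N by [].
have N1 : (0 < N)%N by rewrite /N double_gt0.
have N0N : (N0 <= N)%N by rewrite /N /M; clear; lia.
have inA u i : u \in A -> (`|u i| < N0)%N by move=> uA; apply: hN0; rewrite inE uA.
have inB u i : u \in B -> (`|u i| < N0)%N.
  by move=> uB; apply: hN0; rewrite inE uB orbT.
have sub2 (u v : Zd d) i : (`|u i| < N0)%N -> (`|v i| < N0)%N ->
   (`|(u - v)%R i| < N)%N.
  exact: absz_coordB.
pose T := {ffun 'I_d -> 'I_N}.
pose F (k : T) := dft p1 A f k.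
pose rho (k : T) : R := \sum_i (@qgrid R _ _ k) ord0 i ^+ 2.
pose u (k : T) := cmod (expi (dotp x (@qgrid R _ _ k)) - 1).
pose D : R := (N ^ d)%:R.
have D0 : 0 < D by rewrite ltr0n expn_gt0 N1.
have rho0 k : 0 < rho k.
  rewrite /rho (bigD1 (Ordinal d0)) //= ltr_wpDr //.
    by apply: sumr_ge0 => j _; exact: sqr_ge0.
  have /andP[h _] := qgrid_bounds k (Ordinal d0).
  by rewrite -real_normK ?num_real // exprn_gt0.
have energy : \sum_k (cmod (F k) * Num.sqrt (c * rho k)) ^+ 2 <= D * (E * S - H + e * S).
  have -> : D * (E * S - H + e * S) = \sum_k cmod (F k) ^+ 2 *
     (E - efun_part eh B (pgrid p1 k) + e).
    have e1 := @dft_plancherel A f N N1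
      (fun u v uA vA i => sub2 _ _ _ (inA _ i vA) (inA _ i uA)).
    have e2 := @dft_energy A B f N N1
      (fun u v z uA vA zB i => sub2 _ _ _ (inB _ i zB) (inB _ i (hB _ _ uA vA))) hB.
    transitivity ((E + e) * (\sum_k cmod (F k) ^+ 2) -
       \sum_k cmod (F k) ^+ 2 * efun_part eh B (pgrid p1 k)).
      by rewrite e1 e2 -/S -/H -/D; ring.
    by rewrite mulr_sumr -sumrB; apply: eq_bigr => k _; ring.
  apply: ler_sum => k _; rewrite exprMn.
  rewrite (sqr_sqrtr (_ : 0 <= c * rho k)) ?mulr_ge0 ?(ltW c0) ?(ltW (rho0 k)) //.
  rewrite ler_wpM2l ?sqr_ge0 //.
  have := hB0 B (fsubsetUl _ _) (pgrid p1 k); rewrite ler_norml => /andP[h1 _].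
  have h2 : c * rho k <= E - efun eh (pgrid p1 k).
    by apply: quad => i; have /andP[] := qgrid_bounds k i.
  lra.
have phases : \sum_k (u k / Num.sqrt (c * rho k)) ^+ 2 <= D * K.
  have -> : D * K = c^-1 * (4 * znorm R x `^ a * (N%:R / b) ^+ d).
    rewrite /D /K /pointwise_const natrX (expr_div_n N%:R b); field.
    by rewrite expf_neq0 ?gt_eqF.
  apply: le_trans (ler_wpM2l _ (phase_sum_le x M0)); last by rewrite invr_ge0 ltW.
  rewrite mulr_sumr; apply: ler_sum => k _.
  rewrite expr_div_n (sqr_sqrtr (_ : 0 <= c * rho k)) ?mulr_ge0 ?(ltW c0) ?(ltW (rho0 k)) //.
  by rewrite invfM mulrCA lexx.
have CS := cauchy_schwarz_sum (fun k => cmod (F k) * Num.sqrt (c * rho k))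
   (fun k => u k / Num.sqrt (c * rho k)).
have val : D * cmod (f x) <= \sum_k cmod (F k) * Num.sqrt (c * rho k) *
    (u k / Num.sqrt (c * rho k)).
  have xN y : y \in A -> forall i, (`|(x - y)%R i| < N)%N && (`|y i| < N)%N.
    by move=> yA i; rewrite (leq_trans (inA _ i yA)) ?andbT // sub2 // inA.
  have := congr1 (@cmod R) (dft_eval p1 xA f0 xN).
  rewrite cmodM -(rmorph_nat (real_complex R)) cmodR ger0_norm ?ler0n // => <-.
  apply: le_trans (cmod_sum _ _ _) _; apply: ler_sum => k _.
  rewrite cmodM -mulrA ler_wpM2l ?cmod_ge0 //.
  rewrite mulrCA mulfV ?mulr1; last by rewrite gt_eqF // sqrtr_gt0 mulr_gt0.
  (* The phase at [p1] has modulus one and factors out, leaving [u k]. *)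
  rewrite /pgrid dotpDr expiD -[X in _ - X]mulr1 -mulrBr cmodM cmod_expi mul1r.
  exact: lexx.
have : (D * cmod (f x)) ^+ 2 <= (D * (E * S - H + e * S)) * (D * K).
  apply: le_trans (_ : (\sum_k cmod (F k) * Num.sqrt (c * rho k) *
    (u k / Num.sqrt (c * rho k))) ^+ 2 <= _).
    have l0 : 0 <= D * cmod (f x) by rewrite mulr_ge0 ?cmod_ge0 // ltW.
    by rewrite ler_pXn2r ?nnegrE // (le_trans l0).
  apply: le_trans CS _; apply: ler_pM => //.
    by apply: sumr_ge0 => k _; exact: sqr_ge0.
  by apply: sumr_ge0 => k _; exact: sqr_ge0.
(* The number of grid points enters both sides as [D ^+ 2] and cancels. *)
rewrite exprMn (_ : _ * (D * K) = D ^+ 2 * (K * (E * S - H + e * S))); last by ring.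
by rewrite ler_pM2l ?exprn_gt0.
Qed.

End PointwiseBound.

(** * Quadratic behaviour of the symbol at its extrema *)

Section Taylor.
Variables (R : realType) (d : nat).
Implicit Types (p u w q : 'rV[R]_d) (g : 'rV[R]_d -> R).

(** Both difference quotients are the same function of [h], so one-variable calculus applies along
    lines. *)
Lemma is_derive_line g p u (t : R) : derivable g (p + t *: u) u ->
  is_derive t 1 (fun s : R => g (p + s *: u)) ('D_u g (p + t *: u)).
Proof.
move=> dg.
have E : (fun h : R => h^-1 *: (((fun s : R => g (p + s *: u)) \o shift t) (h *: 1)
    - g (p + t *: u))) =
  (fun h : R => h^-1 *: ((g \o shift (p + t *: u)) (h *: u) - g (p + t *: u))).
  apply/funext => h; congr (_ *: (g _ - _)).
  by rewrite /= [h *: 1]mulr1 scalerDl addrCA.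
by apply: DeriveDef; rewrite /derivable /derive E.
Qed.

Definition box_near p (P : 'rV[R]_d -> Prop) := exists2 del : R, 0 < del &
  forall q, (forall i, `|q ord0 i| <= del) -> P (p + q).

Lemma nbhs_box p (P : set 'rV[R]_d) : nbhs p P -> box_near p P.
Proof.
move=> /nbhs_ballP[e /= e0 he]; exists (e / 2); first by rewrite divr_gt0.
move=> q hq; apply: he; split=> // i j; rewrite mxE ord1.
rewrite /ball /= opprD addrA subrr sub0r normrN.
by apply: le_lt_trans (hq j) _; rewrite ltr_pdivrMr // ltr_pMr // ltr1n.
Qed.

Lemma box_nearI p P Q : box_near p P -> box_near p Q ->
  box_near p (fun q => P q /\ Q q).
Proof.
move=> [a a0 ha] [b b0 hb]; exists (Num.min a b); first by rewrite lt_min a0.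
move=> q hq; split; [apply: ha|apply: hb] => i; have := hq i;
  by rewrite le_min => /andP[].
Qed.

Lemma box_near_continuous p g (e : R) : {for p, continuous g} -> 0 < e ->
  box_near p (fun q => `|g q - g p| <= e).
Proof.
move=> /cvgrPdist_le cg /cg /nbhs_box[del del0 h]; exists del => // q hq.
by rewrite distrC; exact: h.
Qed.

Lemma linear_approx (f df : R -> R) (l e : R) (t : R) :
  (forall s : R, `|s| <= `|t| -> is_derive s 1 f (df s)) ->
  (forall s : R, `|s| <= `|t| -> `|df s - l| <= e) ->
  `|f t - f 0 - t * l| <= e * `|t|.
Proof.
move=> fd dfl; have [c ct ->] := MVT0 fd.
rewrite [t * l]mulrC -mulrBl normrM ler_wpM2r //; exact: dfl.
Qed.

(** Subtracting the quadratic polynomial leaves [psi], whose derivative at [s] is at most [e |s|] by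
    [linear_approx]; a second mean value step gives [e t^2]. *)
Lemma quadratic_approx (f df ddf : R -> R) (l e : R) (t : R) : 0 <= e ->
  (forall s : R, `|s| <= `|t| -> is_derive s 1 f (df s)) ->
  (forall s : R, `|s| <= `|t| -> is_derive s 1 df (ddf s)) ->
  (forall s : R, `|s| <= `|t| -> `|ddf s - l| <= e) ->
  `|f t - f 0 - t * df 0 - t ^+ 2 / 2 * l| <= e * t ^+ 2.
Proof.
move=> e0 fd dfd ddfl.
pose psi : R -> R := f - (df 0 \*: @id R + (l / 2) \*: (@id R ^+ 2)).
have psid (s : R) : `|s| <= `|t| -> is_derive s 1 psi (df s - (df 0 + s * l)).
  move=> st; have hf := fd s st; rewrite /psi.
  by apply: is_derive_eq; rewrite /GRing.scale /=; field.
have [c ct E] := MVT0 psid.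
have -> : f t - f 0 - t * df 0 - t ^+ 2 / 2 * l = psi t - psi 0.
  transitivity (f t - (df 0 * t + (l / 2) * t ^+ 2) -
    (f 0 - (df 0 * 0 + (l / 2) * 0 ^+ 2))); first by field.
  by rewrite /psi !fctE.
rewrite E opprD addrA normrM expr2 -[t * t]ger0_norm; last by rewrite -expr2 sqr_ge0.
rewrite normrM mulrA ler_wpM2r //.
apply: le_trans (_ : e * `|c| <= _); last by rewrite ler_wpM2l.
by apply: (@linear_approx _ ddf) => s sc; [apply: dfd|apply: ddfl]; apply: le_trans ct.
Qed.

(** The remainder is exactly the sum of the three errors on the two-segment path: second order on
    each segment, and the change of the derivative along [w] over the first segment. *)
Lemma taylor_combine (G0 Gh Ghk Du Dw Dwh Duu Duw Dww h k e : R) :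
  `|Ghk - Gh - k * Dwh - k ^+ 2 / 2 * Dww| <= e * k ^+ 2 ->
  `|Gh - G0 - h * Du - h ^+ 2 / 2 * Duu| <= e * h ^+ 2 ->
  `|k * (Dwh - Dw - h * Duw)| <= e * `|h * k| ->
  `|Ghk - G0 - (h * Du + k * Dw)
    - (h ^+ 2 / 2 * Duu + h * k * Duw + k ^+ 2 / 2 * Dww)|
  <= e * (h ^+ 2 + `|h * k| + k ^+ 2).
Proof.
move=> T1 T2 T3; have -> : Ghk - G0 - (h * Du + k * Dw)
    - (h ^+ 2 / 2 * Duu + h * k * Duw + k ^+ 2 / 2 * Dww) =
  (Gh - G0 - h * Du - h ^+ 2 / 2 * Duu) + k * (Dwh - Dw - h * Duw)
    + (Ghk - Gh - k * Dwh - k ^+ 2 / 2 * Dww) by ring.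
rewrite (_ : e * _ = e * h ^+ 2 + e * `|h * k| + e * k ^+ 2); last by rewrite !mulrDr.
apply: le_trans (ler_normD _ _) _; apply: lerD T1.
by apply: le_trans (ler_normD _ _) _; exact: lerD.
Qed.

(* Only directional derivatives are available, so [p + h u + k w] is reached along the
   path [p], [p + h u], [p + h u + k w]. *)
Lemma taylor_directions g p u w :
  (forall j, `|u ord0 j| <= 1) -> (forall j, `|w ord0 j| <= 1) ->
  box_near p (fun q => derivable g q u /\ derivable g q w) ->
  box_near p (fun q => derivable ('D_u g) q u /\ derivable ('D_w g) q w /\
     derivable ('D_w g) q u) ->
  {for p, continuous ('D_u ('D_u g))} -> {for p, continuous ('D_w ('D_w g))} ->
  {for p, continuous ('D_u ('D_w g))} ->
  forall e, 0 < e -> exists2 del : R, 0 < del & forall h k : R, `|h| <= del -> `|k| <= del ->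
    `|g (p + h *: u + k *: w) - g p - (h * 'D_u g p + k * 'D_w g p)
      - (h ^+ 2 / 2 * 'D_u ('D_u g) p + h * k * 'D_u ('D_w g) p
         + k ^+ 2 / 2 * 'D_w ('D_w g) p)|
    <= e * (h ^+ 2 + `|h * k| + k ^+ 2).
Proof.
move=> u1 w1 N1 N2 cuu cww cuw e e0.
have [del2 del20 hdel] := box_nearI (box_nearI N1 N2) (box_nearI
  (box_near_continuous cuu e0) (box_nearI (box_near_continuous cww e0)
  (box_near_continuous cuw e0))).
pose del := del2 / 2; have del0 : 0 < del by rewrite divr_gt0.
have box (h k : R) : `|h| <= del -> `|k| <= del ->
    forall i, `|(h *: u + k *: w) ord0 i| <= del2.
  move=> hd kd i; rewrite !mxE (le_trans (ler_normD _ _)) // !normrM.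
  rewrite (splitr del2) lerD // -[_ / 2]mulr1; apply: ler_pM => //.
pose pt h k := p + (h *: u + k *: w).
have {hdel} dpt h k : `|h| <= del -> `|k| <= del ->
    [/\ derivable g (pt h k) u, derivable g (pt h k) w,
     derivable ('D_u g) (pt h k) u, derivable ('D_w g) (pt h k) w &
     derivable ('D_w g) (pt h k) u] /\
    [/\ `|'D_u ('D_u g) (pt h k) - 'D_u ('D_u g) p| <= e,
    `|'D_w ('D_w g) (pt h k) - 'D_w ('D_w g) p| <= e &
    `|'D_u ('D_w g) (pt h k) - 'D_u ('D_w g) p| <= e].
  move=> hd kd; have [[[H1 H2] [H3 [H4 H5]]] [H6 [H7 H8]]] := hdel _ (box h k hd kd).
  exact: (conj (And5 H1 H2 H3 H4 H5) (And3 H6 H7 H8)).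
have line_w h (s : R) : p + h *: u + s *: w = pt h s by rewrite /pt addrA.
have line_u (s : R) : p + s *: u = pt s 0 by rewrite /pt scale0r addr0.
exists del => // h k hd kd.
have T1 : `|g (pt h k) - g (pt h 0) - k * 'D_w g (pt h 0)
    - k ^+ 2 / 2 * 'D_w ('D_w g) p| <= e * k ^+ 2.
  have := @quadratic_approx (fun s => g (p + h *: u + s *: w))
    (fun s => 'D_w g (p + h *: u + s *: w))
    (fun s => 'D_w ('D_w g) (p + h *: u + s *: w)) ('D_w ('D_w g) p) e k (ltW e0).
  rewrite !line_w; apply=> s sk;
    have [[H1 H2 H3 H4 H5] [H6 H7 H8]] := dpt h s hd (le_trans sk kd).
  - by apply: is_derive_line; rewrite line_w; exact: H2.
  - by apply: is_derive_line; rewrite line_w; exact: H4.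
  - by rewrite line_w; exact: H7.
have zd : `|0 : R| <= del by rewrite normr0 ltW.
have T2 : `|g (pt h 0) - g p - h * 'D_u g p - h ^+ 2 / 2 * 'D_u ('D_u g) p|
    <= e * h ^+ 2.
  have := @quadratic_approx (fun s => g (p + s *: u))
    (fun s => 'D_u g (p + s *: u))
    (fun s => 'D_u ('D_u g) (p + s *: u)) ('D_u ('D_u g) p) e h (ltW e0).
  cbv beta; rewrite scale0r addr0 line_u; apply=> s sk;
    have [[H1 H2 H3 H4 H5] [H6 H7 H8]] := dpt s 0 (le_trans sk hd) zd.
  - by apply: is_derive_line; rewrite line_u; exact: H1.
  - by apply: is_derive_line; rewrite line_u; exact: H3.
  - by rewrite line_u; exact: H6.
have T3 : `|'D_w g (pt h 0) - 'D_w g p - h * 'D_u ('D_w g) p| <= e * `|h|.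
  have := @linear_approx (fun s => 'D_w g (p + s *: u))
    (fun s => 'D_u ('D_w g) (p + s *: u)) ('D_u ('D_w g) p) e h.
  cbv beta; rewrite scale0r addr0 line_u; apply=> s sk;
    have [[H1 H2 H3 H4 H5] [H6 H7 H8]] := dpt s 0 (le_trans sk hd) zd.
  - by apply: is_derive_line; rewrite line_u; exact: H5.
  - by rewrite line_u; exact: H8.
have T3k : `|k * ('D_w g (pt h 0) - 'D_w g p - h * 'D_u ('D_w g) p)| <= e * `|h * k|.
  rewrite !normrM; apply: le_trans (ler_wpM2l (normr_ge0 k) T3) _.
  by rewrite mulrCA [X in _ * X]mulrC.
by rewrite line_w; exact: taylor_combine T1 T2 T3k.
Qed.

End Taylor.

(** * Quadratic forms in two variables *)

Section QuadraticForms.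
Variable R : realType.
Implicit Types a b c h k : R.

(** Second-order Taylor term: half the form of the symmetric matrix with diagonal [a], [c] and
    off-diagonal entry [b]. *)
Definition quad2 a b c h k := h ^+ 2 / 2 * a + h * k * b + k ^+ 2 / 2 * c.

(** Scale [(h, k)] by a small [t]. The linear part dominates, so it is nonpositive, and changing the
    sign of [(h, k)] makes it zero. The quadratic part then scales like the error, whose coefficient
    is arbitrary. *)
Lemma expansion_max (al be a b c : R) :
  (forall e : R, 0 < e -> exists2 del : R, 0 < del & forall h k, `|h| <= del -> `|k| <= del ->
     h * al + k * be + quad2 a b c h k <= e * (h ^+ 2 + `|h * k| + k ^+ 2)) ->
  (forall h k, h * al + k * be = 0) /\ (forall h k, quad2 a b c h k <= 0).
Proof.
move=> H.
have scale del h k t : 0 < t -> t <= del / (1 + `|h| + `|k|) ->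
    `|t * h| <= del /\ `|t * k| <= del.
  move=> t0; have D0 : 0 < 1 + `|h| + `|k| by rewrite !ltr_wpDr.
  rewrite ler_pdivlMr // => td; rewrite !normrM gtr0_norm //.
  have := normr_ge0 h; have := normr_ge0 k.
  by split; apply: le_trans td; rewrite ler_pM2l //; lra.
have quadZ t h k : quad2 a b c (t * h) (t * k) = t ^+ 2 * quad2 a b c h k.
  by rewrite /quad2; ring.
have SZ t h k : (t * h) ^+ 2 + `|t * h * (t * k)| + (t * k) ^+ 2 =
    t ^+ 2 * (h ^+ 2 + `|h * k| + k ^+ 2).
  rewrite (_ : t * h * (t * k) = t ^+ 2 * (h * k)); last by ring.
  by rewrite normrM (ger0_norm (sqr_ge0 t)); ring.
have lin_le0 h k : h * al + k * be <= 0.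
  apply/ler_addgt0Pr => eta eta0; rewrite add0r.
  have [del del0 hdel] := H 1 ltr01.
  set S := h ^+ 2 + `|h * k| + k ^+ 2; set B := quad2 a b c h k.
  have d0 : 0 < del / (1 + `|h| + `|k|) by rewrite divr_gt0 // !ltr_wpDr.
  have d1 : 0 < eta / (1 + `|S - B|) by rewrite divr_gt0 // !ltr_wpDr.
  (* Within the range of validity, and small enough that [t * (1 + |S - B|) <= eta]. *)
  pose t := Num.min (del / (1 + `|h| + `|k|)) (eta / (1 + `|S - B|)).
  have t0 : 0 < t by rewrite lt_min d0.
  have t1 : t <= del / (1 + `|h| + `|k|) by rewrite ge_min lexx.
  have t2 : t <= eta / (1 + `|S - B|) by rewrite ge_min lexx orbT.
  have [th tk] := scale _ _ _ _ t0 t1.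
  have := hdel _ _ th tk; rewrite quadZ SZ -/S -/B mul1r.
  have -> : t * h * al + t * k * be + t ^+ 2 * B = t * (h * al + k * be + t * B).
    by ring.
  rewrite expr2 -mulrA ler_pM2l // -lerBrDr -mulrBr => /le_trans; apply.
  apply: le_trans (_ : t * (1 + `|S - B|) <= _).
    rewrite ler_pM2l //; have := ler_norm (S - B); lra.
  by rewrite -ler_pdivlMr // !ltr_wpDr.
have lin h k : h * al + k * be = 0.
  apply/le_anti; rewrite lin_le0 -oppr_le0.
  by have := lin_le0 (- h) (- k); rewrite !mulNr -opprD.
split=> // h k; apply/ler_addgt0Pr => eta eta0; rewrite add0r.
set S := h ^+ 2 + `|h * k| + k ^+ 2.
have S0 : 0 <= S by rewrite !addr_ge0 ?sqr_ge0.
have S1 : 0 < S + 1 by rewrite ltr_wpDl.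
have [del del0 hdel] := H _ (divr_gt0 eta0 S1).
have t0 : 0 < del / (1 + `|h| + `|k|) by rewrite divr_gt0 // !ltr_wpDr.
have [th tk] := scale _ _ _ _ t0 (lexx _).
have := hdel _ _ th tk; rewrite quadZ SZ lin add0r -/S mulrCA.
rewrite ler_pM2l ?exprn_gt0 // => /le_trans; apply.
rewrite -mulrA ler_piMr ?(ltW eta0) // mulrC ler_pdivrMr // mul1r; lra.
Qed.

(** [2 * lam] is the determinant divided by the absolute value of the trace; for eigenvalues of one
    sign this is at most the smaller of their absolute values. *)
Lemma quad2_neg_def a b c : (forall h k, quad2 a b c h k <= 0) ->
  a * c - b ^+ 2 != 0 ->
  exists2 lam, 0 < lam & forall h k, quad2 a b c h k <= - lam * (h ^+ 2 + k ^+ 2).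
Proof.
move=> neg; rewrite /quad2 in neg *; move=> det.
have a0 : a <= 0 by have := neg 1 0; rewrite expr1n expr0n /=; lra.
have c0 : c <= 0 by have := neg 0 1; rewrite expr1n expr0n /=; lra.
have a1 : a < 0.
  rewrite lt_neqAle a0 andbT; apply/negP => /eqP a00.
  move: det; rewrite a00 mul0r sub0r oppr_eq0 sqrf_eq0 => b0.
  (* With [a = 0] and [b != 0] the form takes the value [1] at this vector. *)
  have := neg ((1 - c / 2) / b) 1; rewrite a00 mulr0 add0r expr1n mulr1 divfK //; lra.
have D0 : 0 < a * c - b ^+ 2.
  rewrite lt_neqAle eq_sym det /=.
  (* At [(b, -a)] the form equals [a / 2] times the determinant, which fixes the sign of the
     latter. *)
  rewrite -(ler_nM2l a1) mulr0; have := neg b (- a).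
  have -> : b ^+ 2 / 2 * a + b * - a * b + (- a) ^+ 2 / 2 * c =
    a * (a * c - b ^+ 2) / 2 by field.
  lra.
have T0 : 0 < - (a + c) by lra.
pose lam := (a * c - b ^+ 2) / - (a + c) / 2.
have lam0 : 0 < lam by rewrite !divr_gt0.
exists lam => // h k.
set A := - a - 2 * lam.
have A0 : 0 < A.
  have -> : A = (a ^+ 2 + b ^+ 2) / - (a + c).
    by rewrite /A /lam; field; rewrite lt_eqF // -oppr_gt0.
  by rewrite divr_gt0 // ltr_wpDr ?sqr_ge0 // exprn_even_gt0 //= lt_eqF.
(* Determinant of the form shifted by [2 * lam]; the choice of [lam] cancels all but the square, and
   completing the square shows that the shifted form is nonnegative. *)
have AC : A * (- c - 2 * lam) - b ^+ 2 = (2 * lam) ^+ 2.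
  by rewrite /A /lam; field; rewrite lt_eqF // -oppr_gt0.
have := sqr_ge0 (A * h - b * k).
have -> : (A * h - b * k) ^+ 2 = A * (A * h ^+ 2 - 2 * b * h * k + (- c - 2 * lam) * k ^+ 2)
   - (A * (- c - 2 * lam) - b ^+ 2) * k ^+ 2 by ring.
rewrite AC => h1.
have h2 : 0 <= A * (A * h ^+ 2 - 2 * b * h * k + (- c - 2 * lam) * k ^+ 2).
  have := mulr_ge0 (sqr_ge0 (2 * lam)) (sqr_ge0 k); lra.
move: h2; rewrite pmulr_rge0 // /A; lra.
Qed.

End QuadraticForms.

(** * Local quadratic bound at a nondegenerate extremum *)

Section LocalBound.
Variables (R : realType) (d : nat) (g : 'rV[R]_d -> R) (p : 'rV[R]_d).
Hypothesis gC2 : exists U, open U /\ U p /\ C2_on U g.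
Let H := hessian g p.

(** The path moves along [i] and then along [j], so the mixed coefficient is [H j i], the derivative
    of [partial j g] along [i]; symmetry is not yet available. The case [i = j] serves dimension
    one. *)
Lemma taylor_C2 (i j : 'I_d) (e : R) : 0 < e ->
  exists2 del : R, 0 < del & forall h k : R, `|h| <= del -> `|k| <= del ->
    `|g (p + h *: unitv R i + k *: unitv R j) - g p
       - (h * partial i g p + k * partial j g p) - quad2 (H i i) (H j i) (H j j) h k|
    <= e * (h ^+ 2 + `|h * k| + k ^+ 2).
Proof.
move=> e0; have [U [Uo [Up [_ [C1 C2]]]]] := gC2.
have unit_le m l : `|unitv R m ord0 l| <= 1.
  by rewrite mxE eqxx /=; case: (_ == _); rewrite ?normr1 ?normr0.
have [del del0 Udel] := nbhs_box (open_nbhs_nbhs (conj Uo Up)).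
have pU : p \in U by rewrite inE.
rewrite /H !mxE; apply: taylor_directions => //.
- by exists del => // q hq; split; apply: (C1 _).1; apply: Udel.
- exists del => // q hq; have Uq := Udel q hq.
  exact: (conj ((C2 i i).1 _ Uq) (conj ((C2 j j).1 _ Uq) ((C2 j i).1 _ Uq))).
- exact: (C2 i i).2 p pU.
- exact: (C2 j j).2 p pU.
- exact: (C2 j i).2 p pU.
Qed.

(* Both orders of the coordinate path give the same Taylor polynomial. *)
Lemma hessian_sym i j : H i j = H j i.
Proof.
apply/eqP; rewrite -subr_eq0 -normr_eq0 eq_le normr_ge0 andbT.
apply/ler_addgt0Pr => e e0; rewrite add0r.
(* At [h = k = t] each expansion errs by at most [3 t^2 * e / 6], so the two together by at most
   [e t^2]. *)
have e6 : 0 < e / 6 by rewrite divr_gt0.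
have [d1 d10 h1] := taylor_C2 i j e6; have [d2 d20 h2] := taylor_C2 j i e6.
pose t := Num.min d1 d2; have t0 : 0 < t by rewrite lt_min d10.
have t1 : `|t| <= d1 by rewrite gtr0_norm // ge_min lexx.
have t2 : `|t| <= d2 by rewrite gtr0_norm // ge_min lexx orbT.
have := h1 t t t1 t1; have := h2 t t t2 t2.
rewrite (addrAC p); set G := g _; rewrite /quad2.
have -> : `|t * t| = t ^+ 2 by rewrite -expr2 ger0_norm ?sqr_ge0.
move: (g p) (partial i g p) (partial j g p) (H i i) (H j j) (H i j) (H j i).
move=> g0 pi pj a c b b' k1 k2.
have : `|t ^+ 2 * (b - b')| <= t ^+ 2 * e.
  rewrite ler_norml; move: k1 k2; rewrite !ler_norml => /andP[? ?] /andP[? ?].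
  by apply/andP; split; lra.
by rewrite normrM ger0_norm ?sqr_ge0 // ler_pM2l // exprn_gt0.
Qed.

Variable s : R.
Hypothesis s1 : `|s| = 1.
Hypothesis gmax : forall q, s * (g (p + q) - g p) <= 0.


Let ler_norm_mul_unit (x : R) : - (s * x) <= `|x|.
Proof. by rewrite -mulrN (le_trans (ler_norm _)) // normrM s1 mul1r normrN. Qed.

(** The sign [s] treats maxima ([s = 1]) and minima ([s = -1]) together. *)
Lemma max_expansion i j :
  (forall h k, h * (s * partial i g p) + k * (s * partial j g p) = 0) /\
  (forall h k, quad2 (s * H i i) (s * H j i) (s * H j j) h k <= 0).
Proof.
apply: expansion_max => e e0.
have [del del0 hdel] := taylor_C2 i j e0; exists del => // x y xd yd.
have := hdel x y xd yd; set Q := quad2 _ _ _ x y.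
have -> : quad2 (s * H i i) (s * H j i) (s * H j j) x y = s * Q.
  by rewrite /Q /quad2; ring.
have := gmax (x *: unitv R i + y *: unitv R j); rewrite addrA.
move: (g (_ + _)) (g p) (partial i g p) (partial j g p) => G G0 u w h1 h2.
have {}h2 := le_trans (ler_norm_mul_unit _) h2.
lra.
Qed.

(** The gradient term vanishes, and a Taylor error with coefficient [lam / 3] costs at most half of
    [lam] because [|h k| <= (h^2 + k^2) / 2]. The predicate [P] restricts to [k = 0] in dimension
    one, where the form in two variables would be degenerate. *)
Lemma max_upper_bound i j (lam : R) (P : R -> Prop) : 0 < lam ->
  (forall h k, P k -> quad2 (s * H i i) (s * H j i) (s * H j j) h k
     <= - lam * (h ^+ 2 + k ^+ 2)) ->
  exists2 del : R, 0 < del & forall h k : R, `|h| <= del -> `|k| <= del -> P k ->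
    lam / 2 * (h ^+ 2 + k ^+ 2) <=
      s * (g p - g (p + h *: unitv R i + k *: unitv R j)).
Proof.
move=> lam0 Hlam; have l3 : 0 < lam / 3 by rewrite divr_gt0.
have [del del0 hdel] := taylor_C2 i j l3; exists del => // x y xd yd Py.
have := hdel x y xd yd; have := Hlam x y Py; set Q := quad2 (H _ _) _ _ x y.
have -> : quad2 (s * H i i) (s * H j i) (s * H j j) x y = s * Q.
  by rewrite /Q /quad2; ring.
have [L _] := max_expansion i j; have {L} := L x y.
have xy : `|x * y| <= (x ^+ 2 + y ^+ 2) / 2.
  have := sqr_ge0 (`|x| - `|y|); rewrite normrM sqrrB !real_normK ?num_real //; lra.
move: (g (_ + _)) (g p) (partial i g p) (partial j g p) => G G0 u w h0 h1.
rewrite -normrN => h2; have {}h2 := le_trans (ler_norm_mul_unit _) h2.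
have h3 : lam / 3 * (x ^+ 2 + `|x * y| + y ^+ 2) <= lam / 2 * (x ^+ 2 + y ^+ 2).
  have -> : lam / 2 * (x ^+ 2 + y ^+ 2) =
    lam / 3 * (x ^+ 2 + (x ^+ 2 + y ^+ 2) / 2 + y ^+ 2) by field.
  by rewrite ler_pM2l //; lra.
lra.
Qed.

End LocalBound.

Section LocalBoundLowDim.
Variable R : realType.

Lemma det_mx22 (M : 'M[R]_2) :
  \det M = M ord0 ord0 * M ord_max ord_max - M ord0 ord_max * M ord_max ord0.
Proof.
rewrite (expand_det_row M ord0) big_ord_recl big_ord1 /cofactor !det_mx11 !mxE /=.
rewrite expr0 expr1 mul1r mulN1r mulrN.
by congr (M _ _ * M _ _ - M _ _ * M _ _); apply/val_inj.
Qed.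

Lemma local_max_bound d (g : 'rV[R]_d -> R) (p : 'rV[R]_d) (s : R) :
  (d == 1)%N || (d == 2)%N -> nondeg_C2_at g p -> `|s| = 1 ->
  (forall q, s * (g (p + q) - g p) <= 0) ->
  exists2 c : R, 0 < c & exists2 del : R, 0 < del &
    forall q : 'rV[R]_d, (forall i, `|q ord0 i| <= del) ->
      c * \sum_i q ord0 i ^+ 2 <= s * (g p - g (p + q)).
Proof.
move=> /orP[/eqP|/eqP] dE; subst d => -[gC2 Hu] s1 gmax.
  have a0 : hessian g p ord0 ord0 != 0.
    by move: Hu; rewrite unitmxE det_mx11 unitfE.
  have s0 : s != 0 by rewrite -normr_eq0 s1 oner_eq0.
  have [_ Q] := max_expansion gC2 s1 gmax ord0 ord0.
  have a1 : s * hessian g p ord0 ord0 < 0.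
    rewrite lt_neqAle mulf_neq0 //=.
    by have := Q 1 0; rewrite /quad2 expr1n expr0n /=; lra.
  pose lam := - (s * hessian g p ord0 ord0) / 2.
  have lam0 : 0 < lam by rewrite divr_gt0 // oppr_gt0.
  have [|del del0 hdel] := max_upper_bound gC2 s1 gmax (i := ord0) (j := ord0)
    (P := fun k => k = 0) lam0.
    by move=> h k ->; rewrite /quad2 /lam; lra.
  exists (lam / 2); [by rewrite divr_gt0|exists del => // q hq].
  have := hdel (q ord0 ord0) 0 (hq ord0).
  rewrite normr0 (ltW del0) big_ord1 expr0n /= addr0 scale0r addr0.
  have -> : q ord0 ord0 *: unitv R ord0 = q.
    by apply/rowP => i; rewrite !mxE !ord1 eqxx mulr1.
  exact.
have det0 : hessian g p ord0 ord0 * hessian g p ord_max ord_max -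
    hessian g p ord_max ord0 ^+ 2 != 0.
  move: Hu; rewrite unitmxE det_mx22 unitfE.
  by rewrite (hessian_sym gC2 ord0 ord_max) expr2.
have [_ Q] := max_expansion gC2 s1 gmax ord0 ord_max.
have sE : s ^+ 2 = 1 by rewrite -real_normK ?num_real // s1 expr1n.
have [|lam lam0 Hlam] := quad2_neg_def Q.
  have -> : s * hessian g p ord0 ord0 * (s * hessian g p ord_max ord_max) -
    (s * hessian g p ord_max ord0) ^+ 2 = s ^+ 2 * (hessian g p ord0 ord0 *
      hessian g p ord_max ord_max - hessian g p ord_max ord0 ^+ 2) by ring.
  by rewrite sE mul1r.
have [|del del0 hdel] := max_upper_bound gC2 s1 gmax (i := ord0) (j := ord_max)
    (P := fun=> True) lam0.
  by move=> h k _; exact: Hlam.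
exists (lam / 2); [by rewrite divr_gt0|exists del => // q hq].
have := hdel (q ord0 ord0) (q ord0 ord_max) (hq ord0) (hq ord_max) I.
have -> : \sum_i q ord0 i ^+ 2 = q ord0 ord0 ^+ 2 + q ord0 ord_max ^+ 2.
  by rewrite big_ord_recr big_ord1 /=; congr (q _ _ ^+ 2 + _); apply/val_inj.
rewrite -addrA; have -> // : q ord0 ord0 *: unitv R ord0 +
    q ord0 ord_max *: unitv R ord_max = q.
apply/rowP => -[[|[|//]] hi]; rewrite !mxE /=.
  by rewrite mulr1 mulr0 addr0; congr (q _ _); apply/val_inj.
by rewrite mulr1 mulr0 add0r; congr (q _ _); apply/val_inj.
Qed.

End LocalBoundLowDim.

(** * Continuity and periodicity of the symbol *)

Section SymbolRegularity.
Variables (R : realType) (d : nat).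
Implicit Types (p q : 'rV[R]_d) (x z : Zd d).

Lemma box_near_continuousP (g : 'rV[R]_d -> R) :
  (forall p e, 0 < e -> box_near p (fun q => `|g q - g p| <= e)) -> continuous g.
Proof.
move=> H p; apply/(@cvgrPdist_le _ _ _ _ (nbhs_filter p)) => e /(H p)[del del0 hdel].
apply/nbhs_ballP; exists del => //= q [_ hq]; rewrite distrC.
have -> : q = p + (q - p) by rewrite addrC subrK.
apply: hdel => i; have := hq ord0 i; rewrite !mxE /ball /= distrC.
exact: ltW.
Qed.

Lemma mul_continuous (T : topologicalType) (f h : T -> R) :
  continuous f -> continuous h -> continuous (fun t => f t * h t).
Proof.
move=> cf ch t; apply: (@cvgM _ _ _ (nbhs_filter t)); [exact: cf|exact: ch].
Qed.

Lemma sub_continuous (T : topologicalType) (f h : T -> R) :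
  continuous f -> continuous h -> continuous (fun t => f t - h t).
Proof.
move=> cf ch t; apply: (@cvgB _ _ _ _ (nbhs_filter t)); [exact: cf|exact: ch].
Qed.

Lemma sum_continuous (T : topologicalType) (I : Type) (r : seq I) (F : I -> T -> R) :
  (forall i, continuous (F i)) -> continuous (fun t => \sum_(i <- r) F i t).
Proof.
move=> cF; elim: r => [|i r IH] t.
  rewrite (_ : (fun t => _) = (fun=> 0)); last first.
    by apply/funext => u; rewrite big_nil.
  exact: cvg_cst.
rewrite (_ : (fun t => _) = (fun t => F i t + \sum_(j <- r) F j t)); last first.
  by apply/funext => u; rewrite big_cons.
by apply: (@cvgD _ _ _ _ (nbhs_filter t)); [exact: cF|exact: IH].
Qed.

Lemma dotp_continuous x : continuous (@dotp R d x).
Proof.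
apply: sum_continuous => i; apply: mul_continuous; last exact: coord_continuous.
exact: cst_continuous.
Qed.

Definition lattice_shift z : 'rV[R]_d := \row_i ((z i)%:~R * (2 * pi)).

Lemma expi_dotp_shift x z p : expi (dotp x (p + lattice_shift z)) = expi (dotp x p).
Proof.
rewrite dotpDr expiD (_ : dotp x (lattice_shift z) = (\sum_i x i * z i)%:~R * (2 * pi)).
  by rewrite expi_2pi_int mulr1.
rewrite rmorph_sum mulr_suml; apply: eq_bigr => i _.
by rewrite mxE rmorphM mulrA.
Qed.

Lemma torus_shift p : exists z, torus d (p + lattice_shift z).
Proof.
have P0 : 0 < 2 * pi :> R by rewrite mulr_gt0 // pi_gt0.
(* The ceiling matches the half-open interval, which contains [pi] but not [- pi]. *)
exists [ffun i => - Num.ceil ((p ord0 i - pi) / (2 * pi))] => i.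
rewrite !mxE ffunE; set c := Num.ceil _.
have /andP[] := ceil_itv ((p ord0 i - pi) / (2 * pi)); rewrite -/c.
rewrite rmorphB /= ltr_pdivlMr // ler_pdivrMr // mulrBl mul1r rmorphN mulNr.
by move: (c%:~R * _) => u h1 h2; apply/andP; split; lra.
Qed.

Variable eh : Zd d -> R[i].
Hypothesis eh1 : abs_summable eh.

Lemma efun_shift p z : efun eh (p + lattice_shift z) = efun eh p.
Proof.
by rewrite /efun; congr (complex.Re (csum _)); apply/funext => x; rewrite expi_dotp_shift.
Qed.

Lemma efun_part_continuous B : continuous (@efun_part R d eh B).
Proof.
apply: sum_continuous => z.
have -> : (fun p => complex.Re (eh z * expi (dotp z p))) =
   (fun p => complex.Re (eh z) * cos (dotp z p) - complex.Im (eh z) * sin (dotp z p)).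
  by apply/funext => p; case: (eh z).
apply: sub_continuous; apply: mul_continuous; try exact: cst_continuous.
  move=> p; apply: (@continuous_comp _ _ _ (dotp z) cos).
    exact: dotp_continuous.
  exact: continuous_cos.
move=> p; apply: (@continuous_comp _ _ _ (dotp z) sin).
  exact: dotp_continuous.
exact: continuous_sin.
Qed.

Lemma efun_continuous : continuous (@efun R d eh).
Proof.
apply: box_near_continuousP => p e e0.
have e3 : 0 < e / 3 by rewrite divr_gt0.
have [B hB] := efun_approx eh1 e3.
have {}hB := hB B (fsubset_refl _).
have [del del0 hdel] := box_near_continuous (@efun_part_continuous B p) e3.
exists del => // q /hdel; have := hB (p + q); have := hB p.
move: (efun eh _) (efun eh _) (efun_part _ _ _) (efun_part _ _ _) => a b a' b'.
rewrite !ler_norml => /andP[? ?] /andP[? ?] /andP[? ?]; apply/andP; split; lra.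
Qed.

End SymbolRegularity.

(** * From the local bound to the whole period cell *)

Section GlobalBound.
Variables (R : realType) (d : nat) (g : 'rV[R]_d -> R) (p : 'rV[R]_d) (s : R).
Hypothesis d12 : (d == 1)%N || (d == 2)%N.
Hypothesis g_continuous : continuous g.
Hypothesis g_periodic : forall q z, g (q + lattice_shift R z) = g q.
Hypothesis p_torus : torus d p.
Hypothesis s1 : `|s| = 1.
Hypothesis p_max : forall q, torus d q -> s * g q <= s * g p.
Hypothesis p_unique : forall q, torus d q -> g q = g p -> q = p.
Hypothesis p_C2 : nondeg_C2_at g p.

Let gmax q : s * (g (p + q) - g p) <= 0.
Proof.
have [z hz] := torus_shift (p + q).
by have := p_max hz; rewrite g_periodic mulrBr subr_le0.
Qed.

(** By periodicity and uniqueness, equality would place [q] in [2 pi Z^d], which meets this closed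
    cube only at the origin. *)
Let gmax_strict (q : 'rV[R]_d) : (forall i, `|q ord0 i| <= pi) -> q != 0 ->
  0 < s * (g p - g (p + q)).
Proof.
move=> qpi q0; rewrite lt_neqAle -[X in _ && X]oppr_le0 -mulrN opprB gmax andbT.
have s0 : s != 0 by rewrite -normr_eq0 s1 oner_eq0.
rewrite eq_sym mulf_neq0 // subr_eq0; apply: contra_neqN q0 => /eqP gE.
have [z hz] := torus_shift (p + q).
have qE : p + q + lattice_shift R z = p.
  by apply: p_unique => //; rewrite g_periodic.
have {qE} qE : q = - lattice_shift R z.
  by apply/eqP; rewrite -addr_eq0; apply/eqP/(addrI p); rewrite addr0 addrA.
apply/rowP => i; have := qpi i; rewrite qE !mxE normrN normrM.
rewrite (ger0_norm (_ : 0 <= 2 * pi)) ?mulr_ge0 ?pi_ge0 // => zi.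
have : `|(z i)%:~R| < 1 :> R.
  rewrite -(ltr_pM2r (_ : 0 < 2 * pi)) ?mulr_gt0 ?pi_gt0 // mul1r.
  by apply: le_lt_trans zi _; rewrite ltr_pMl ?pi_gt0 // ltr1n.
rewrite -intr_norm -[1]/(1%:~R) ltr_int => z1.
have -> : z i = 0 by move: z1; clear; lia.
by rewrite mul0r oppr0.
Qed.

(** Away from the origin the gap is continuous and positive on the compact set [K], so it has a
    positive minimum [m], while the sum of squares is at most [S = d pi^2] on the cube. *)
Lemma global_max_bound : exists2 c : R, 0 < c &
  forall q : 'rV[R]_d, (forall i, `|q ord0 i| <= pi) ->
    c * \sum_i q ord0 i ^+ 2 <= s * (g p - g (p + q)).
Proof.
have [c c0 [del del0 hdel]] := local_max_bound d12 p_C2 s1 gmax.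
pose box := [set q : 'rV[R]_d | forall i, `[- pi, pi]%classic (q ord0 i)].
pose K := box `&` [set q : 'rV[R]_d | del ^+ 2 <= \sum_i q ord0 i ^+ 2].
have boxE q : box q <-> (forall i, `|q ord0 i| <= pi).
  split=> h i; first by have := h i; rewrite /= in_itv /= ler_norml.
  by rewrite /= in_itv /= -ler_norml.
have sq_cont : continuous (fun q : 'rV[R]_d => \sum_i q ord0 i ^+ 2).
  apply: sum_continuous => i.
  by apply: mul_continuous; exact: coord_continuous.
have cK : compact K.
  apply: compact_closedI; last first.
    move/continuous_closedP : sq_cont => /(_ [set x | del ^+ 2 <= x]); apply.
    exact: closed_ge.
  exact: (rV_compact (fun i : 'I_d => @segment_compact R (- pi) pi)).
have small q : ~ K q -> (forall i, `|q ord0 i| <= pi) ->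
    c * \sum_i q ord0 i ^+ 2 <= s * (g p - g (p + q)).
  move=> nK qpi; apply: hdel => i.
  have : \sum_i q ord0 i ^+ 2 < del ^+ 2.
    by rewrite ltNge; apply/negP => h; apply: nK; split=> //; apply/boxE.
  rewrite (bigD1 i) //= => h.
  rewrite -(ler_pXn2r (n := 2)) ?nnegrE ?(ltW del0) // real_normK ?num_real //.
  apply: le_trans (ltW h); rewrite lerDl; apply: sumr_ge0 => j _; exact: sqr_ge0.
(* If [del] is so large that [K] is empty, the local bound covers the cube. *)
have [K0|K0] := pselect (K !=set0); last first.
  by exists c => // q; apply: small => Kq; apply: K0; exists q.
have m_cont : continuous (fun q => s * (g p - g (p + q))).
  apply: mul_continuous; first exact: cst_continuous.
  apply: sub_continuous; first exact: cst_continuous.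
  move=> q; apply: (@continuous_comp _ _ _ (fun q => p + q) g); last exact: g_continuous.
  apply: (@cvgD _ _ _ _ (nbhs_filter q)); [exact: cst_continuous|exact: cvg_id].
have [q0 q0K qmin] := compact_EVT_min K0 cK (continuous_subspaceT m_cont).
set m := s * _ in qmin.
have m0 : 0 < m.
  move: q0K; rewrite inE => -[/boxE q0b q0del]; apply: gmax_strict => //.
  apply: contraTneq q0del => ->; rewrite -ltNge big1 ?exprn_gt0 // => i _.
  by rewrite mxE expr0n.
pose S : R := \sum_(i < d) pi ^+ 2.
have S0 : 0 < S + 1.
  by rewrite ltr_wpDl // sumr_ge0 // => i _; exact: sqr_ge0.
exists (Num.min c (m / (S + 1))); first by rewrite lt_min c0 divr_gt0.
move=> q qpi; have q2 : 0 <= \sum_i q ord0 i ^+ 2.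
  by apply: sumr_ge0 => i _; exact: sqr_ge0.
have [Kq|nKq] := pselect (K q); last first.
  by apply: le_trans (small q nKq qpi); rewrite ler_wpM2r // ge_min lexx.
apply: le_trans (qmin q _); last by rewrite inE.
apply: le_trans (_ : m / (S + 1) * (S + 1) <= _); last by rewrite divfK // gt_eqF.
apply: ler_pM; rewrite ?le_min ?(ltW c0) ?divr_ge0 ?(ltW m0) ?(ltW S0) //.
  by rewrite ge_min lexx orbT.
apply: le_trans (_ : S <= _); last by rewrite lerDl.
apply: ler_sum => i _; rewrite -real_normK ?num_real //.
by rewrite ler_pXn2r ?nnegrE ?pi_ge0.
Qed.

End GlobalBound.

(** * Eigenvalues beyond one edge of the band *)

Section OneSided.
Variables (R : realType) (d : nat) (eh : Zd d -> R[i]) (p1 : 'rV[R]_d) (E c g : R).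
Hypothesis d12 : (d == 1)%N || (d == 2)%N.
Hypothesis eh1 : abs_summable eh.
Hypothesis eh_herm : forall x : Zd d, cconj (eh (- x)) = eh x.
Hypothesis c0 : 0 < c.
Hypothesis quad : forall q : 'rV[R]_d, (forall i, `|q ord0 i| <= pi) ->
  c * \sum_i q ord0 i ^+ 2 <= E - efun eh (p1 + q).
Hypotheses (g0 : 0 < g) (g1 : g < 1).
Variables (v : Zd d -> R) (mu : R).
Hypothesis v_sum : (wsum g v < +oo)%E.
Hypothesis mu0 : 0 < mu.
Variables (n : nat) (f : 'I_n -> Zd d -> R[i]) (Es : 'I_n -> R).
Hypothesis f_indep : lin_indep f.
Hypothesis f_eig : forall k, is_eigvec (hmu eh v mu) (f k) (Es k) /\ E < Es k.

Let f2 k : ell2 (f k). Proof. by have [[]] := f_eig k. Qed.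

Lemma gformJ (u w : Zd d -> R[i]) A : gform w u A = (gform u w A)^*%C.
Proof.
rewrite conjc_sum; apply: eq_bigr => x _.
by rewrite conjcM conjcK mulrC.
Qed.

Lemma hformJ (u w : Zd d -> R[i]) A : hform eh w u A = (hform eh u w A)^*%C.
Proof.
rewrite /hform conjc_sum exchange_big; apply: eq_bigr => x _ /=.
rewrite conjc_sum; apply: eq_bigr => y _; rewrite /hkernel /=.
rewrite !conjcM conjcK -(eh_herm (x - y)) cconjE opprB; ring.
Qed.

Definition vform (u w : Zd d -> R[i]) (A : {fset Zd d}) : R[i] :=
  \sum_(x <- A) (u x)^*%C * ((mu * v x)%:C%C * w x).

Lemma vformJ u w A : vform w u A = (vform u w A)^*%C.
Proof.
rewrite conjc_sum; apply: eq_bigr => x _.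
by rewrite !conjcM conjcK conjc_real; ring.
Qed.

Definition qform (u w : Zd d -> R[i]) A : R[i] := E%:C%C * gform u w A - hform eh u w A.

(** The matrix entry [<f_j, (E - h_0) f_k>], with the kernel summed over pairs of sites; square
    truncations, to which the Fourier bound applies, converge to it. *)
Definition Qlim (j k : 'I_n) : R[i] := E%:C%C * csum (fun x => (f j x)^*%C * f k x)
  - csum (hkernel eh (f j) (f k)).

Lemma qform_netlim j k : netlim (qform (f j) (f k)) (Qlim j k).
Proof.
apply: netlimB; first by apply: netlimZ; exact: gform_netlim.
exact: hform_netlim.
Qed.

Lemma qformJ u w A : qform w u A = (qform u w A)^*%C.
Proof. by rewrite /qform rmorphB /= conjcM conjc_real gformJ hformJ. Qed.

Lemma Qlim_herm j k : Qlim k j = (Qlim j k)^*%C.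
Proof.
apply: (netlim_uniq (@qform_netlim k j)).
rewrite (_ : qform (f k) (f j) = fun A => (qform (f j) (f k) A)^*%C).
  exact: netlimJ (@qform_netlim j k).
by apply/funext => A; exact: qformJ.
Qed.

Lemma sum_lcomb (F : Zd d -> Zd d -> R[i]) (A : {fset Zd d}) (a b : 'I_n -> R[i]) :
  \sum_(x <- A) \sum_(y <- A) (lcomb f a x)^*%C * F x y * lcomb f b y =
  \sum_j \sum_k (a j)^*%C * b k *
     \sum_(x <- A) \sum_(y <- A) (f j x)^*%C * F x y * f k y.
Proof.
transitivity (\sum_(x <- A) \sum_(y <- A) \sum_j \sum_k
    (a j)^*%C * b k * ((f j x)^*%C * F x y * f k y)).
  apply: eq_bigr => x _; apply: eq_bigr => y _.
  rewrite /lcomb conjc_sum !mulr_suml; apply: eq_bigr => j _.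
  rewrite mulr_sumr; apply: eq_bigr => k _.
  by rewrite conjcM; ring.
under eq_bigr do rewrite exchange_big; rewrite exchange_big; apply: eq_bigr => j _ /=.
under eq_bigr do rewrite exchange_big; rewrite exchange_big; apply: eq_bigr => k _ /=.
by rewrite mulr_sumr; apply: eq_bigr => x _; rewrite mulr_sumr.
Qed.

Lemma hform_lcomb (a b : 'I_n -> R[i]) A :
  hform eh (lcomb f a) (lcomb f b) A =
  \sum_j \sum_k (a j)^*%C * b k * hform eh (f j) (f k) A.
Proof. exact: (sum_lcomb (fun x y => eh (y - x))). Qed.

Lemma vform_lcomb (a b : 'I_n -> R[i]) A :
  vform (lcomb f a) (lcomb f b) A = \sum_j \sum_k (a j)^*%C * b k * vform (f j) (f k) A.
Proof.
transitivity (\sum_(x <- A) \sum_j \sum_k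
    (a j)^*%C * b k * ((f j x)^*%C * ((mu * v x)%:C%C * f k x))).
  apply: eq_bigr => x _.
  rewrite /lcomb conjc_sum !mulr_suml; apply: eq_bigr => j _.
  rewrite !mulr_sumr; apply: eq_bigr => k _.
  by rewrite conjcM; ring.
rewrite exchange_big; apply: eq_bigr => j _; rewrite exchange_big.
by apply: eq_bigr => k _; rewrite mulr_sumr.
Qed.

Lemma gform_lcomb (a b : 'I_n -> R[i]) A :
  gform (lcomb f a) (lcomb f b) A = \sum_j \sum_k (a j)^*%C * b k * gform (f j) (f k) A.
Proof.
transitivity (\sum_(x <- A) \sum_j \sum_k (a j)^*%C * b k * ((f j x)^*%C * f k x)).
  apply: eq_bigr => x _.
  rewrite /lcomb conjc_sum !mulr_suml; apply: eq_bigr => j _.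
  rewrite !mulr_sumr; apply: eq_bigr => k _.
  by rewrite conjcM; ring.
rewrite exchange_big; apply: eq_bigr => j _; rewrite exchange_big.
by apply: eq_bigr => k _; rewrite mulr_sumr.
Qed.

Lemma gform_diag (u : Zd d -> R[i]) A : gform u u A = (\sum_(x <- A) cmod (u x) ^+ 2)%:C%C.
Proof. by rewrite rmorph_sum; apply: eq_bigr => x _; rewrite mulJc. Qed.

Lemma sesq_qform_netlim (a : 'I_n -> R[i]) :
  netlim (fun A => \sum_j \sum_k (a j)^*%C * a k * qform (f j) (f k) A)
    (sesq Qlim a a).
Proof.
apply: netlim_sum => j; apply: netlim_sum => k; apply: netlimZ.
exact: qform_netlim.
Qed.

Lemma qform_lcomb (a : 'I_n -> R[i]) (A : {fset Zd d}) :
  E * (\sum_(x <- A) cmod (lcomb f a x) ^+ 2) - complex.Re (hform eh (lcomb f a) (lcomb f a) A)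
  = complex.Re (\sum_j \sum_k (a j)^*%C * a k * qform (f j) (f k) A).
Proof.
transitivity (complex.Re (qform (lcomb f a) (lcomb f a) A)).
  by rewrite /qform ReD ReN gform_diag ReZ.
rewrite /qform gform_lcomb hform_lcomb mulr_sumr -sumrB; congr complex.Re.
apply: eq_bigr => j _; rewrite mulr_sumr -sumrB; apply: eq_bigr => k _.
by rewrite /qform mulrBr mulrCA.
Qed.

Let d0 : (0 < d)%N. Proof. by case/orP: d12 => /eqP ->. Qed.
Let gd : g < d%:R. Proof. by apply: lt_le_trans g1 _; rewrite ler1n. Qed.
Let a0 : 0 <= 2 - d%:R + g.
Proof.
rewrite addr_ge0 ?(ltW g0) // subr_ge0 ler_nat.
by case/orP: d12 => /eqP ->.
Qed.

Let K := pointwise_const d c g.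
Let K0 : 0 < K. Proof. exact: pointwise_const_gt0. Qed.
Let w (x : Zd d) := K * znorm R x `^ (2 - d%:R + g).
Let w0 x : 0 <= w x. Proof. by rewrite mulr_ge0 ?powR_ge0 // ltW. Qed.

(** The left side of [pointwise_bound] does not change as the truncation set grows, while the form
    on its right side converges to the limiting one. *)
Lemma eval_bound_lcomb (a : 'I_n -> R[i]) : lcomb f a 0 = 0 ->
  forall x, cmod (lcomb f a x) ^+ 2 <= w x * complex.Re (sesq Qlim a a).
Proof.
move=> fa0 x; apply/ler_addgt0Pr => e e0.
have w1 : 0 < w x + 1 by apply: ltr_wpDl.
have [A0 hA0] := sesq_qform_netlim a (divr_gt0 e0 w1).
have := hA0 (x |` A0)%fset (fsubsetUr _ _).
set A := (x |` A0)%fset; have xA : x \in A by rewrite !inE eqxx.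
set S := \sum_j _ => hS.
have {}hS : complex.Re S - complex.Re (sesq Qlim a a) <= e / (w x + 1).
  by rewrite -ReN -ReD (le_trans _ hS) // (le_trans (ler_norm _)) // cmod_Re.
apply: le_trans (pointwise_bound eh1 d0 c0 quad g0 gd a0 fa0 xA) _.
rewrite qform_lcomb -/S -/(w x).
apply: le_trans (_ : w x * (complex.Re (sesq Qlim a a) + e / (w x + 1)) <= _).
  by rewrite ler_wpM2l // -lerBlDl.
rewrite mulrDr lerD2l mulrCA ler_piMr ?(ltW e0) //.
by rewrite ler_pdivrMr // mul1r lerDl.
Qed.

Lemma h0_eigen k x : h0 eh (f k) x = (Es k)%:C%C * f k x - (mu * v x)%:C%C * f k x.
Proof.
have [[_ [_ eig]] _] := f_eig k.
by rewrite -eig /hmu addrK.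
Qed.

(** [hform_h0] replaces the truncated form by the full [h0] acting on [f k], and the eigenvalue
    equation eliminates [h0]. *)
Lemma qform_eigen j k : netlim (fun A => qform (f j) (f k) A -
  ((E - Es k)%:C%C * gform (f j) (f k) A + vform (f j) (f k) A)) 0.
Proof.
have := netlimZ (-1) (hform_h0 eh1 (f2 j) (f2 k)); rewrite mulr0.
apply: eq_netlim => A.
have -> : gform (f j) (h0 eh (f k)) A =
    (Es k)%:C%C * gform (f j) (f k) A - vform (f j) (f k) A.
  rewrite /gform mulr_sumr -sumrB; apply: eq_bigr => x _.
  by rewrite h0_eigen; ring.
by rewrite /qform rmorphB /=; ring.
Qed.

(** The classical argument for symmetric operators on truncations: in the conjugate of [qform_eigen]
    for [(k, j)] minus that for [(j, k)] the Hermitian forms [qform] and [vform] cancel, leaving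
    [(Es j - Es k)] times [gform]. *)
Lemma eigen_orthogonal j k : Es j != Es k ->
  netlim (gform (f j) (f k)) 0.
Proof.
move=> jk; have := netlimJ (qform_eigen k j); rewrite conjc0 => h.
have := netlimB h (qform_eigen j k); rewrite subr0 => {}h.
have Ejk : (Es j - Es k)%:C%C != 0.
  by rewrite eq_complex /= eqxx andbT subr_eq0.
have := netlimZ (Es j - Es k)%:C%C^-1 h; rewrite mulr0.
apply: eq_netlim => A.
rewrite (qformJ (f j) (f k)) (gformJ (f j) (f k)) (vformJ (f j) (f k)).
move: (qform (f j) (f k) A) (gform (f j) (f k) A) (vform (f j) (f k) A) Ejk.
move=> q u u' Ejk; rewrite conjcB conjcD conjcM conjc_real !conjcK.
rewrite !rmorphB /=; field.
by rewrite -rmorphB.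
Qed.

(* With [s_k = sqrt (E_k - E)], the orthogonality of eigenvectors for different eigenvalues
   turns [sum conj(a_j) a_k (E_k - E) <f_j, f_k>] into the squared norm of
   [sum s_k a_k f_k], which is nonnegative. *)
Lemma sesq_upper (a : 'I_n -> R[i]) (e : R) : 0 < e ->
  exists A0 : {fset Zd d}, forall A, (A0 `<=` A)%fset ->
    complex.Re (sesq Qlim a a) <=
    \sum_(x <- A) (mu * `|v x|) * cmod (lcomb f a x) ^+ 2 + e.
Proof.
move=> e0; pose s k := Num.sqrt (Es k - E).
have sE k : s k ^+ 2 = Es k - E.
  by rewrite sqr_sqrtr // subr_ge0 ltW //; have [] := f_eig k.
pose W A := \sum_j \sum_k (a j)^*%C * a k *
  (vform (f j) (f k) A - (s j * s k)%:C%C * gform (f j) (f k) A).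
have Wlim : netlim W (sesq Qlim a a).
  have term j k : netlim (fun A => (a j)^*%C * a k *
    (qform (f j) (f k) A - ((E - Es k)%:C%C * gform (f j) (f k) A + vform (f j) (f k) A)
     + ((s j * s k - s k ^+ 2)%:C%C * gform (f j) (f k) A))) 0.
    rewrite -(mulr0 ((a j)^*%C * a k)); apply: netlimZ.
    rewrite -[0]addr0; apply: netlimD; first exact: qform_eigen.
    (* Equal eigenvalues make the coefficient vanish; for distinct ones [gform] tends to zero. *)
    have [EE|/eigen_orthogonal h] := eqVneq (Es j) (Es k).
      rewrite /s EE -expr2 subrr rmorph0.
      by apply: eq_netlim (netlim_cst _ 0) => A; rewrite mul0r.
    by rewrite -(mulr0 (s j * s k - s k ^+ 2)%:C%C); exact: netlimZ.
  apply: (netlim_squeeze (sesq_qform_netlim a)).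
  apply: eq_netlim (netlim_sum0 _ (fun j => netlim_sum0 _ (term j))) => A.
  rewrite /W -sumrB; apply: eq_bigr => j _; rewrite -sumrB; apply: eq_bigr => k _.
  by rewrite sE !rmorphB /=; ring.
have [A0 hA0] := Wlim e e0; exists A0 => A /hA0 hA.
have {}hA : complex.Re (sesq Qlim a a) <= complex.Re (W A) + e.
  rewrite -lerBlDl -ReN -ReD (le_trans _ hA) // cmodB.
  by rewrite (le_trans (ler_norm _)) // cmod_Re.
apply: le_trans hA _; rewrite lerD2r.
have -> : W A = vform (lcomb f a) (lcomb f a) A -
    gform (lcomb f (fun k => (s k)%:C%C * a k)) (lcomb f (fun k => (s k)%:C%C * a k)) A.
  rewrite vform_lcomb gform_lcomb -sumrB; apply: eq_bigr => j _.
  rewrite -sumrB; apply: eq_bigr => k _.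
  by rewrite conjcM conjc_real rmorphM /=; ring.
rewrite gform_diag ReD ReN /= lerBlDr.
apply: le_trans (_ : \sum_(x <- A) mu * `|v x| * cmod (lcomb f a x) ^+ 2 + 0 <= _).
  rewrite addr0 Re_sum; apply: ler_sum => x _.
  rewrite mulrCA mulJc -rmorphM /= ler_wpM2r ?sqr_ge0 //.
  by rewrite ler_pM2l // ler_norm.
by rewrite lerD2l; apply: sumr_ge0 => x _; exact: sqr_ge0.
Qed.

Lemma one_sided_count : n%:R <= 1 + K * mu * fine (wsum g v).
Proof.
have f_free (a : 'I_n -> R[i]) : (forall x, lcomb f a x = 0) -> forall k, a k = 0.
  exact: f_indep.
apply: (@dim_bound R _ n Qlim f Qlim_herm 0 w f_free eval_bound_lcomb w0
  (fun x => mu * `|v x|)) => [x|A|a e].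
- by rewrite mulr_ge0 // ltW.
- pose W x := powR (znorm R x) (2 - d%:R + g) * `|v x|.
  have W0 x : 0 <= W x by rewrite mulr_ge0 ?powR_ge0.
  have -> : \sum_(x <- A) mu * `|v x| * w x = K * mu * \sum_(x <- A) W x.
    by rewrite mulr_sumr; apply: eq_bigr => x _; rewrite /w /W; ring.
  apply: ler_wpM2l; first exact: ltW (mulr_gt0 K0 mu0).
  exact: (@fsum_le_esumr _ _ W A W0 v_sum).
- exact: sesq_upper.
Qed.

End OneSided.

(** * Change of sign and conclusion for both edges *)

Section SignChange.
Variables (R : realType) (d : nat).

Lemma rsumN (T : choiceType) (h : T -> R) : rsum (fun x => - h x) = - rsum h.
Proof.
by rewrite /rsum opprB; under [in X in _ - X]eq_esum do rewrite opprK.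
Qed.

Lemma csumN (T : choiceType) (h : T -> R[i]) : csum (fun x => - h x) = - csum h.
Proof.
rewrite /csum (_ : (fun x => complex.Re _) = fun x => - complex.Re (h x)).
  rewrite (_ : (fun x => complex.Im _) = fun x => - complex.Im (h x)).
    by rewrite !rsumN.
  by apply/funext => x; rewrite ImN.
by apply/funext => x; rewrite ReN.
Qed.

Implicit Types (eh f : Zd d -> R[i]).

Lemma efunN eh p : efun (fun x => - eh x) p = - efun eh p.
Proof.
rewrite /efun; under [X in csum X]eq_fun do rewrite mulNr.
by rewrite csumN ReN.
Qed.

Lemma hmuN eh (v : Zd d -> R) mu f x :
  hmu (fun x => - eh x) (fun x => - v x) mu f x = - hmu eh v mu f x.
Proof.
rewrite /hmu /h0; under [X in csum X]eq_fun do rewrite mulNr.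
by rewrite csumN mulrN rmorphN mulNr opprD.
Qed.

Lemma wsumN g (v : Zd d -> R) : wsum g (fun x => - v x) = wsum g v.
Proof. by apply: eq_esum => x _; rewrite normrN. Qed.

Lemma abs_summableN eh : abs_summable eh -> abs_summable (fun x => - eh x).
Proof.
by move=> h; apply: le_lt_trans h; apply: le_esum => x _; rewrite lee_fin cmodN.
Qed.

Lemma emaxE eh p1 : torus d p1 -> (forall p, torus d p -> efun eh p <= efun eh p1) ->
  emax eh = efun eh p1.
Proof.
move=> tp1 pmax; apply/le_anti/andP; split.
  apply: ge_sup; first by exists (efun eh p1); exists p1.
  by move=> _ [p tp <-]; exact: pmax.
apply: ub_le_sup; last by exists p1.
by exists (efun eh p1) => _ [p tp <-]; exact: pmax.
Qed.

Lemma eminE eh p0 : torus d p0 -> (forall p, torus d p -> efun eh p0 <= efun eh p) ->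
  emin eh = efun eh p0.
Proof.
move=> tp0 pmin; apply/le_anti/andP; split.
  apply: ge_inf; last by exists p0.
  by exists (efun eh p0) => _ [p tp <-]; exact: pmin.
apply: lb_le_inf; first by exists (efun eh p0); exists p0.
by move=> _ [p tp <-]; exact: pmin.
Qed.

End SignChange.

Theorem theorem1p1 (R : realType) (d : nat) (hd : (d == 1)%N || (d == 2)%N)
  (eh : Zd d -> R[i])
  (eh_l1 : abs_summable eh)
  (eh_herm : forall x : Zd d, cconj (eh (- x)) = eh x)
  (Ha : hyp_a eh)
  (gamma : R) (hg0 : 0 < gamma) (hg1 : gamma < 1) :
  exists C1 C2 : R, 0 < C1 /\ 0 < C2 /\
    forall (v : Zd d -> R),
      (0 < wsum gamma v)%E -> (wsum gamma v < +oo)%E ->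
      forall mu : R, 0 < mu ->
        (forall (n : nat) (fs : 'I_n -> Zd d -> R[i]) (Es : 'I_n -> R),
           lin_indep fs ->
           (forall k, is_eigvec (hmu eh v mu) (fs k) (Es k) /\ emax eh < Es k) ->
           (n%:R <= 1 + C1 * mu * fine (wsum gamma v) :> R)) /\
        (forall (n : nat) (fs : 'I_n -> Zd d -> R[i]) (Es : 'I_n -> R),
           lin_indep fs ->
           (forall k, is_eigvec (hmu eh v mu) (fs k) (Es k) /\ Es k < emin eh) ->
           (n%:R <= 1 + C2 * mu * fine (wsum gamma v) :> R)).
Proof.
have [[p0 [tp0 [pmin [pminU pminC]]]] [p1 [tp1 [pmax [pmaxU pmaxC]]]]] := Ha.
have d0 : (0 < d)%N by case/orP: hd => /eqP ->.
have cont := efun_continuous eh_l1.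
have [c1 c10 q1] : exists2 c : R, 0 < c & forall q : 'rV[R]_d,
    (forall i, `|q ord0 i| <= pi) ->
    c * \sum_i q ord0 i ^+ 2 <= 1 * (efun eh p1 - efun eh (p1 + q)).
  apply: global_max_bound => //; first exact: efun_shift.
    by rewrite normr1.
  by move=> q tq; rewrite !mul1r; exact: pmax.
have [c2 c20 q2] : exists2 c : R, 0 < c & forall q : 'rV[R]_d,
    (forall i, `|q ord0 i| <= pi) ->
    c * \sum_i q ord0 i ^+ 2 <= -1 * (efun eh p0 - efun eh (p0 + q)).
  apply: global_max_bound => //; first exact: efun_shift.
    by rewrite normrN normr1.
  by move=> q tq; rewrite !mulN1r lerN2; exact: pmin.
(* Both constants are fixed before [v] and [mu] are introduced; [c1] and [c2] come from the symbol
   alone. *)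
exists (pointwise_const d c1 gamma), (pointwise_const d c2 gamma).
split; first exact: pointwise_const_gt0.
split; first exact: pointwise_const_gt0.
move=> v _ vfin mu mu0; split=> n fs Es fs_indep fs_eig.
  apply: (@one_sided_count R d eh p1 (efun eh p1) c1) => //.
  - by move=> q hq; rewrite -[leRHS]mul1r; exact: q1.
  - exact: fs_indep.
  - by move=> k; rewrite -(emaxE tp1 pmax).
rewrite -wsumN.
apply: (@one_sided_count R d (fun x => - eh x) p0 (- efun eh p0) c2 gamma hd _ _ _ _ _ _
  (fun x => - v x) mu _ _ n fs (fun k => - Es k)) => //.
- exact: abs_summableN.
- by move=> x; rewrite -[in RHS]eh_herm !cconjE rmorphN.
- by move=> q hq; rewrite efunN -opprD -mulN1r; exact: q2.
- by rewrite wsumN.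
- move=> k; have [[l2 [nz eig]] lt] := fs_eig k.
  split; last by rewrite ltrN2 -(eminE tp0 pmin).
  split; [exact: l2|split; [exact: nz|move=> x]].
  by rewrite hmuN eig rmorphN mulNr.
Qed.
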